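(* Let $a, b \in \mathbb{C}\setminus\{0\}$, $c>0$, $c>|a|+|b|+1$, $0<\lambda\le1$ and $0\le\beta<1$. Assume that $$\frac{\Gamma(c)\,\Gamma(c-|a|-|b|)}{\Gamma(c-|a|)\,\Gamma(c-|b|)}\left[\frac{|a|\,(|b|)_2}{(c-|a|)(c-|a|-|b|-1)}\;{}_2F_1(|a|+1,|b|+2;c-|a|+1;-1)+\lambda\;{}_2F_1(|a|,|b|;c-|a|;-1)\right]\le\lambda\left(\frac1{2(1-\beta)}+1\right).$$ Then the operator $\mathcal{I}^{a,\frac b2,\frac{b+1}2}_{\frac c2,\frac{c+1}2}$ maps $\mathcal{R}(\beta)$ into $\mathcal{C}_\lambda$.
   Context: $\mathbb{D}=\{z\in\mathbb{C}:|z|<1\}$. $\mathcal{A}$ is the family of analytic functions $f$ on $\mathbb{D}$ of the form $f(z)=z+\sum_{n\ge2}a_nz^n$. For $\lambda>0$, $\mathcal{S}^*_\lambda=\{f\in\mathcal{A}: |zf'(z)/f(z)-1|<\lambda,\ z\in\mathbb{D}\}$ and $\mathcal{C}_\lambda=\{f\in\mathcal{A}: zf'(z)\in\mathcal{S}^*_\lambda\}$. For $\beta<1$, $\mathcal{R}(\beta)$ is the set of $f\in\mathcal{A}$ for which there exists $\phi\in\mathbb{R}$ with $\operatorname{Re}\left(e^{i\phi}(f'(z)-\beta)\right)>0$ for all $z\in\mathbb{D}$. Pochhammer symbol: $(x)_0=1$, $(x)_n=x(x+1)\cdots(x+n-1)$ for $n\ge1$. Clausen's hypergeometric function is ${}_3F_2(a,b,c;d,e;z)=\sum_{n=0}^\infty\frac{(a)_n(b)_n(c)_n}{(d)_n(e)_n(1)_n}z^n$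 for $|z|<1$, with $d,e\ne0,-1,-2,\dots$. The integral operator is defined for $f(z)=z+\sum_{n\ge2}a_nz^n\in\mathcal{A}$ by the convolution (coefficientwise product) $$\mathcal{I}^{a,\frac b2,\frac{b+1}2}_{\frac c2,\frac{c+1}2}(f)(z)=z\,{}_3F_2\left(a,\tfrac b2,\tfrac{b+1}2;\tfrac c2,\tfrac{c+1}2;z\right)*f(z)=z+\sum_{n=2}^\infty\frac{(a)_{n-1}\left(\frac b2\right)_{n-1}\left(\frac{b+1}2\right)_{n-1}}{\left(\frac c2\right)_{n-1}\left(\frac{c+1}2\right)_{n-1}(1)_{n-1}}\,a_nz^n.$$ ${}_2F_1(a,b;c;z)$ is the Gauss hypergeometric function, i.e. $\sum_{n\ge0}\frac{(a)_n(b)_n}{(c)_n(1)_n}z^n$ for $|z|<1$, continued analytically to $\mathbb{C}\setminus[1,\infty)$ (so its value at $-1$ makes sense). *)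

(* Defs.v *)
From Stdlib Require Import Reals Factorial.
From Coquelicot Require Import Coquelicot.
Open Scope R_scope.

Definition in_disc (z : C) : Prop := Cmod z < 1.

Definition expands_on_disc (f : C -> C) (u : nat -> C) : Prop :=
  forall z : C, in_disc z -> is_pseries u z (f z).

(* Sum of a complex power series, meaningful where the series converges. *)
Definition C_PSeries (u : nat -> C) (z : C) : C :=
  iota (T := C_CompleteNormedModule) (fun l : C => is_pseries u z l).

Lemma C_PSeries_unique (u : nat -> C) (z l : C) :
  is_pseries u z l -> C_PSeries u z = l.
Proof.
intros Hl.
refine (@iota_unique C_AbsRing C_CompleteNormedModule
          (fun y : C => is_pseries u z y) l (fun y Hy => _) Hl).
exact (@filterlim_locally_unique nat C_AbsRing C_NormedModule
         eventually _ _ y l Hy Hl).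
Qed.

Definition analytic_at (f : C -> C) (z0 : C) : Prop :=
  exists (u : nat -> C) (r : R), 0 < r /\
    forall z : C, Cmod (z - z0) < r -> is_pseries u (z - z0)%C (f z).

Fixpoint C_derive_n (f : C -> C) (n : nat) : C -> C :=
  match n with
  | O => f
  | S m => C_derive (C_derive_n f m)
  end.

Definition taylor_coeff (f : C -> C) (n : nat) : C :=
  (C_derive_n f n 0 / RtoC (INR (Factorial.fact n)))%C.

(* Functions are total on C; only their values on the unit disc matter. *)
Definition class_A (f : C -> C) : Prop :=
  exists u : nat -> C,
    u 0%nat = RtoC 0 /\ u 1%nat = RtoC 1 /\ expands_on_disc f u.

(* At z = 0 the quotient z f'(z) / f(z) is read as its limit 1, so that the
   condition is void there; elsewhere f must not vanish for the quotient to be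
   defined (division by 0 returns a dummy value). *)
Definition class_S (lam : R) (f : C -> C) : Prop :=
  class_A f /\
  forall z : C, in_disc z -> z <> RtoC 0 ->
    f z <> RtoC 0 /\ Cmod (z * C_derive f z / f z - 1)%C < lam.

Definition class_C (lam : R) (f : C -> C) : Prop :=
  class_A f /\ class_S lam (fun z : C => (z * C_derive f z)%C).

Definition class_R (beta : R) (f : C -> C) : Prop :=
  class_A f /\
  exists phi : R, forall z : C, in_disc z ->
    0 < Re ((cos phi, sin phi) * (C_derive f z - RtoC beta))%C.

Fixpoint C_poch (x : C) (n : nat) : C :=
  match n with
  | O => RtoC 1
  | S m => (C_poch x m * (x + RtoC (INR m)))%C
  end.

Fixpoint R_poch (x : R) (n : nat) : R :=
  match n with
  | O => 1
  | S m => R_poch x m * (x + INR m)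
  end.

Definition coeff_3F2 (a b c d e : C) (n : nat) : C :=
  (C_poch a n * C_poch b n * C_poch c n
   / (C_poch d n * C_poch e n * C_poch 1 n))%C.

Definition coeff_2F1 (a b c : C) (n : nat) : C :=
  (C_poch a n * C_poch b n / (C_poch c n * C_poch 1 n))%C.

(* f |-> z 3F2(a,b,c;d,e;z) * f(z), with * the coefficientwise product: the
   Taylor coefficient of z^n in z 3F2(a,b,c;d,e;z) is 0 for n = 0 and
   coeff_3F2 a b c d e (n - 1) for n >= 1. *)
Definition clausen_operator (a b c d e : C) (f : C -> C) : C -> C :=
  C_PSeries (fun n : nat =>
    match n with
    | O => RtoC 0
    | S m => (coeff_3F2 a b c d e m * taylor_coeff f n)%C
    end).

Definition in_slit_plane (z : C) : Prop := ~ (Im z = 0 /\ 1 <= Re z).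

(* F is the analytic continuation to C \ [1, +oo) of the Gauss series; since
   the slit plane is connected, F is uniquely determined there. *)
Definition is_2F1 (a b c : C) (F : C -> C) : Prop :=
  expands_on_disc F (coeff_2F1 a b c) /\
  forall z : C, in_slit_plane z -> analytic_at F z.

(* Euler's integral, for s > 0. *)
Definition Gamma (s : R) : R :=
  RInt_gen (fun t : R => Rpower t (s - 1) * exp (- t))
    (at_right 0) (Rbar_locally p_infty).

(* Main.v *)
(** If [f' - beta] times a unimodular constant has positive real part, then
    Caratheodory's inequality gives [n |a_n| <= 2 (1 - beta)]; and a function
    [z + sum h_n z^n] with [sum_(n >= 2) (n - 1 + lam) |h_n| <= lam] lies in
    [class_S lam]. With [A = |a|], [B = |b|] everything therefore reduces to
    [sum_m (m + lam) T_m <= lam (1 / (2 (1 - beta)) + 1)], where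
    [T_m = (A)_m (B)_(2m) / ((c)_(2m) m!)] dominates the Clausen coefficients.

    The sums of [T_m] and [m T_m] are evaluated through
    [(1 - t^2)^(-A) = (1 - t)^(-A) (1 - x t)^(-A)] at [x = -1]: apply the
    functional [t^n |-> (B)_n / (c)_n]. For [|x| < 1] expanding in powers of
    [x] and using Gauss's summation theorem for each coefficient yields
    Gamma factors times [2F1(A, B; c - A; x)]. The limit [x -> -1] is a dominated
    one because the Taylor coefficients in [t] are nonnegative for
    [-1 <= x <= 0] and bounded uniformly in [x]; on the side of the
    hypergeometric function it only uses continuity of the continuation at [-1]. *)

Require Import Defs.
From Stdlib Require Import Reals Lra Lia Psatz.
From Coquelicot Require Import Coquelicot.
Open Scope R_scope.

(** * Euler's Gamma function *)

(** The obstacle is that the Gauss series need not converge at [-1] under the hypotheses, so nothing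
    can be evaluated there term by term. The majorant for the passage to [-1] consists of the
    coefficients of [(1 - t)^(- A')] with [A' = Rmax A 1]; its summability against [(B)_n / (c)_n]
    asks for [A' + B < c]. The weight [m] in the sum of [m T_m] costs no new evaluation:
    [m (A)_m / m!] is [A (A + 1)_(m-1) / (m-1)!], so this sum is, up to a factor, the sum of [T_m]
    with [(A, B, c)] replaced by [(A + 1, B + 2, c + 2)]. Summability at the shifted parameters is
    exactly [c > A + B + 1], and the shift produces the first Gauss function of the hypothesis.
    Gauss's theorem rests on a recurrence: both sides satisfy the same relation between [c] and
    [c + 1], and both tend to 1 as [c] grows. For the Gamma quotient this limit comes from a
    correlation inequality instead of asymptotics. *)

Lemma is_RInt_gen_nonneg_bounded (f : R -> R) (M : R) :
  (forall t, 0 < t -> 0 <= f t) ->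
  (forall t, 0 < t -> continuous f t) ->
  (forall x y, 0 < x <= y -> RInt f x y <= M) ->
  exists l, is_RInt_gen f (at_right 0) (Rbar_locally p_infty) l.
Proof.
intros Hpos Hcont HM.
assert (Hex : forall x y, 0 < x <= y -> ex_RInt f x y).
{ intros x y Hxy; apply (@ex_RInt_continuous R_CompleteNormedModule); intros z Hz; apply Hcont.
  rewrite Rmin_left in Hz by lra; lra. }
(* The limit is the supremum over compact intervals: by nonnegativity, every interval larger than a
   nearly optimal one is at least as close to it. *)
destruct (completeness (fun v => exists x y, 0 < x <= y /\ v = RInt f x y))
  as [l [Hub Hlub]].
- exists M; intros v (x & y & Hxy & ->); now apply HM.
- exists (RInt f 1 1), 1, 1; split; [lra | reflexivity].
- exists l; intros P [eps HP].
  assert (Hx0 : exists x y, 0 < x <= y /\ l - eps < RInt f x y).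
  { apply Classical_Prop.NNPP; intros Hn.
    assert (l <= l - eps); [apply Hlub|destruct eps; simpl in *; lra].
    intros v (x & y & Hxy & ->); apply Rnot_lt_le; intros Hlt.
    apply Hn; exists x, y; now split. }
  destruct Hx0 as (x0 & y0 & Hxy0 & Hl).
  apply Filter_prod with (Q := fun x => 0 < x < x0) (R := fun y => y0 < y).
  + assert (Hx0 : 0 < x0) by lra; exists (mkposreal x0 Hx0).
    intros y Hy Hy0; split; [exact Hy0|].
    apply Rabs_lt_between in Hy; unfold minus, plus, opp in Hy; simpl in Hy.
    lra.
  + exists y0; now intros.
  + intros x y Hx Hy; exists (RInt f x y); split.
    * apply (@RInt_correct R_CompleteNormedModule), Hex; simpl; lra.
    * assert (H0 : 0 <= RInt f x x0).
      { apply RInt_ge_0; [lra | apply Hex; lra |]. intros; apply Hpos; lra. }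
      assert (H1 : 0 <= RInt f y0 y).
      { apply RInt_ge_0; [lra | apply Hex; lra |]. intros; apply Hpos; lra. }
      assert (E1 := @RInt_Chasles R_CompleteNormedModule f x x0 y (Hex x x0 ltac:(lra)) (Hex x0 y ltac:(lra))).
      assert (E2 := @RInt_Chasles R_CompleteNormedModule f x0 y0 y (Hex x0 y0 ltac:(lra)) (Hex y0 y ltac:(lra))).
      unfold plus in E1, E2; simpl in E1, E2.
      assert (RInt f x y <= l).
      { apply Hub; exists x, y; split; [lra | reflexivity]. }
      apply HP; unfold ball; simpl; unfold AbsRing_ball, abs, minus, plus, opp; simpl.
      apply Rabs_lt_between; destruct eps; simpl in *; lra.
Qed.

Lemma filter_prod_0_infty (m M : R) : 0 < m ->
  filter_prod (at_right 0) (Rbar_locally p_infty)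
    (fun ab => 0 < fst ab < m /\ M < snd ab).
Proof.
intros Hm.
apply Filter_prod with (Q := fun x => 0 < x < m) (R := fun y => M < y).
- exists (mkposreal m Hm); intros y Hy Hy0; split; [exact Hy0|].
  apply Rabs_lt_between in Hy; unfold minus, plus, opp in Hy; simpl in Hy.
  lra.
- exists M; now intros.
- simpl; intros; lra.
Qed.

(** Enlarging the interval can only increase the integral, so a compact integral above [l] would
    contradict convergence to [l]. Lower bounds on improper integrals are extracted this way. *)
Lemma RInt_le_is_RInt_gen_0_infty (f : R -> R) (l x0 y0 : R) :
  (forall t, 0 < t -> 0 <= f t) ->
  (forall t, 0 < t -> continuous f t) ->
  is_RInt_gen f (at_right 0) (Rbar_locally p_infty) l ->
  0 < x0 <= y0 -> RInt f x0 y0 <= l.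
Proof.
intros Hpos Hcont Hl Hxy0; apply Rnot_lt_le; intros Hneg.
assert (Hex : forall x y, 0 < x <= y -> ex_RInt f x y).
{ intros x y Hxy; apply (@ex_RInt_continuous R_CompleteNormedModule); intros z Hz; apply Hcont.
  rewrite Rmin_left in Hz by lra; lra. }
assert (He : 0 < RInt f x0 y0 - l) by lra.
assert (HP := Hl _ (locally_ball l (mkposreal _ He))); unfold filtermapi in HP.
assert (H := filter_and _ _ HP (filter_prod_0_infty x0 y0 ltac:(lra))).
assert (HF : ProperFilter (filter_prod (at_right 0) (Rbar_locally p_infty)))
  by (apply filter_prod_proper; typeclasses eauto).
destruct (filter_ex _ H) as [[x y] [[v [Hi Hb]] Hxy]]; simpl in *.
apply (@is_RInt_unique R_CompleteNormedModule) in Hi.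
assert (H0 : 0 <= RInt f x x0).
{ apply RInt_ge_0; [lra | apply Hex; lra |]. intros; apply Hpos; lra. }
assert (H1 : 0 <= RInt f y0 y).
{ apply RInt_ge_0; [lra | apply Hex; lra |]. intros; apply Hpos; lra. }
assert (E1 := @RInt_Chasles R_CompleteNormedModule f x x0 y (Hex x x0 ltac:(lra)) (Hex x0 y ltac:(lra))).
assert (E2 := @RInt_Chasles R_CompleteNormedModule f x0 y0 y (Hex x0 y0 ltac:(lra)) (Hex y0 y ltac:(lra))).
unfold plus in E1, E2; simpl in E1, E2.
unfold ball in Hb; simpl in Hb; unfold AbsRing_ball, abs, minus, plus, opp in Hb; simpl in Hb.
apply Rabs_lt_between in Hb; lra.
Qed.

Lemma exp_le_compat (x y : R) : x <= y -> exp x <= exp y.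
Proof. intros [H | ->]; [now left; apply exp_increasing | now right]. Qed.

Lemma ln_le_sub_1 (x : R) : 0 < x -> ln x <= x - 1.
Proof.
intros Hx; rewrite <- (ln_exp (x - 1)); apply ln_le; [exact Hx|].
assert (H := exp_ineq1_le (x - 1)); lra.
Qed.

(* The bound is the integral of the derivative of [(t / (1 + t))^s / s], since
   [(1 + t)^(s+1) exp (- t)] is bounded. *)
Lemma is_RInt_gen_Gamma (s : R) : 0 < s ->
  is_RInt_gen (fun t : R => Rpower t (s - 1) * exp (- t))
    (at_right 0) (Rbar_locally p_infty) (Gamma s).
Proof.
intros Hs.
assert (Hc : forall t, 0 < t -> continuous (fun t : R => Rpower t (s - 1) * exp (- t)) t).
{ intros t Ht; apply @ex_derive_continuous; unfold Rpower; auto_derive; lra. }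
(* [M] is the maximum of [(1 + t)^(s+1) exp (- t)], attained at [t = s]. *)
set (M := exp ((s + 1) * ln (s + 1) - s)).
set (Q := fun t => M * / s * exp (s * (ln t - ln (1 + t)))).
set (dQ := fun t => M * / s * (exp (s * (ln t - ln (1 + t))) * (s * (/ t - / (1 + t))))).
assert (HQ : forall t, 0 < t -> is_derive Q t (dQ t)).
{ intros t Ht; unfold Q, dQ; auto_derive; [lra | unfold Rminus; field; lra]. }
destruct (is_RInt_gen_nonneg_bounded (fun t : R => Rpower t (s - 1) * exp (- t)) (M * / s))
  as [l Hl].
- intros t Ht; unfold Rpower; apply Rmult_le_pos; apply Rlt_le, exp_pos.
- exact Hc.
- intros x y Hxy.
  assert (HI : is_RInt dQ x y (Q y - Q x)).
  { apply (is_RInt_derive Q dQ); intros t Ht; rewrite Rmin_left, Rmax_right in Ht by lra.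
    - apply HQ; lra.
    - apply @ex_derive_continuous; unfold dQ; auto_derive; lra. }
  apply Rle_trans with (Q y - Q x).
  + rewrite <- (is_RInt_unique _ _ _ _ HI).
    apply RInt_le; [lra | | now exists (Q y - Q x) |].
    * apply (@ex_RInt_continuous R_CompleteNormedModule); intros z Hz; apply Hc; rewrite Rmin_left in Hz by lra; lra.
    * intros t Ht; unfold dQ, Rpower.
      assert (Ht0 : 0 < t) by lra.
      replace (M * / s * (exp (s * (ln t - ln (1 + t))) * (s * (/ t - / (1 + t)))))
        with (M * exp (s * (ln t - ln (1 + t))) * (/ t * / (1 + t))) by (field; lra).
      replace (/ t * / (1 + t)) with (exp (- ln t - ln (1 + t))).
      2:{ rewrite <- (exp_ln (/ t)), <- (exp_ln (/ (1 + t))).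
          2,3: apply Rinv_0_lt_compat; lra.
          rewrite <- exp_plus, !ln_Rinv by lra; f_equal; ring. }
      unfold M; rewrite <- !exp_plus.
      apply exp_le_compat.
      assert (Hl := ln_le_sub_1 ((1 + t) / (s + 1)) ltac:(apply Rdiv_lt_0_compat; lra)).
      rewrite ln_div in Hl by lra.
      assert (E : (s + 1) * ((1 + t) / (s + 1) - 1) = t - s) by (field; lra).
      assert (H := Rmult_le_compat_l (s + 1) _ _ ltac:(lra) Hl); rewrite E in H.
      lra.
  + assert (HM : 0 < M * / s).
    { apply Rmult_lt_0_compat; [apply exp_pos | now apply Rinv_0_lt_compat]. }
    assert (H1 : 0 <= Q x) by (unfold Q; apply Rmult_le_pos; [lra | apply Rlt_le, exp_pos]).
    assert (H2 : Q y <= M * / s * 1).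
    { unfold Q; apply Rmult_le_compat_l; [lra|]. apply Rle_trans with (exp 0); [|rewrite exp_0; lra].
      assert (ln y <= ln (1 + y)) by (apply ln_le; lra).
      apply exp_le_compat; nra. }
    lra.
- unfold Gamma; rewrite (is_RInt_gen_unique _ _ Hl); exact Hl.
Qed.

Lemma Gamma_pos (s : R) : 0 < s -> 0 < Gamma s.
Proof.
intros Hs.
apply Rlt_le_trans with (RInt (fun t : R => Rpower t (s - 1) * exp (- t)) 1 2).
- apply RInt_gt_0; [lra | intros; apply Rmult_lt_0_compat; apply exp_pos |].
  intros; apply @ex_derive_continuous; unfold Rpower; auto_derive; lra.
- apply RInt_le_is_RInt_gen_0_infty; [| | now apply is_RInt_gen_Gamma | lra].
  + intros; apply Rmult_le_pos; apply Rlt_le, exp_pos.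
  + intros; apply @ex_derive_continuous; unfold Rpower; auto_derive; lra.
Qed.

(** Half of the exponential absorbs the power; the other half is kept as decay at infinity. *)
Lemma Rpower_exp_le (s t : R) : 0 < s -> 0 < t ->
  Rpower t s * exp (- t) <= exp (s * ln (2 * s)) * exp (- (t / 2)).
Proof.
intros Hs Ht; unfold Rpower; rewrite <- !exp_plus; apply exp_le_compat.
assert (Hl := ln_le_sub_1 (t / (2 * s)) ltac:(apply Rdiv_lt_0_compat; lra)).
rewrite ln_div in Hl by lra.
assert (E : s * (t / (2 * s) - 1) = t / 2 - s) by (field; lra).
assert (H := Rmult_le_compat_l s _ _ ltac:(lra) Hl); rewrite E in H.
lra.
Qed.

(** Integration by parts: [f = t^s exp (- t)] vanishes at both ends, so its derivative has integral
    0. *)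
Lemma Gamma_succ (s : R) : 0 < s -> Gamma (s + 1) = s * Gamma s.
Proof.
intros Hs.
set (f := fun t : R => Rpower t s * exp (- t)).
set (df := fun t : R => s * (Rpower t (s - 1) * exp (- t)) - Rpower t (s + 1 - 1) * exp (- t)).
assert (Hd : forall t, 0 < t -> is_derive f t (df t)).
{ intros t Ht; unfold f, df, Rpower; replace (s + 1 - 1) with s by ring.
  auto_derive; [lra|].
  replace ((s - 1) * ln t) with (s * ln t + - ln t) by ring.
  rewrite exp_plus, (exp_Ropp (ln t)), exp_ln by lra; field; lra. }
assert (Hord := filter_prod_0_infty 1 1 Rlt_0_1).
assert (HD : is_RInt_gen (Derive f) (at_right 0) (Rbar_locally p_infty) (0 - 0)).
{ apply is_RInt_gen_Derive.
  - revert Hord; apply filter_imp; intros [a b] H x; simpl in *.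
    rewrite Rmin_left, Rmax_right by lra; intros Hx.
    exists (df x); apply Hd; lra.
  - revert Hord; apply filter_imp; intros [a b] H x; simpl in *.
    rewrite Rmin_left, Rmax_right by lra; intros Hx.
    apply continuous_ext_loc with df.
    + assert (Hx0 : 0 < x) by lra; exists (mkposreal x Hx0).
      intros y Hy; apply Rabs_lt_between in Hy; unfold minus, plus, opp in Hy; simpl in Hy.
      symmetry; apply is_derive_unique, Hd; lra.
    + apply @ex_derive_continuous; unfold df, Rpower; auto_derive; lra.
  - apply filterlim_locally; intros eps.
    (* The radius is [eps^(1/s)], below which [t^s < eps]. *)
    assert (Hd0 : 0 < exp (ln eps / s)) by apply exp_pos.
    exists (mkposreal _ Hd0); intros t Ht Ht0.
    unfold ball in *; simpl in *; unfold AbsRing_ball, abs, minus, plus, opp in *; simpl in *.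
    rewrite Ropp_0, Rplus_0_r, Rabs_pos_eq in *; try lra.
    2: unfold f; apply Rmult_le_pos; apply Rlt_le, exp_pos.
    assert (exp (- t) <= 1) by (rewrite <- exp_0; apply exp_le_compat; lra).
    assert (Rpower t s < eps).
    { rewrite <- (exp_ln eps) by apply cond_pos; unfold Rpower; apply exp_increasing.
      apply ln_increasing in Ht; [|lra]; rewrite ln_exp in Ht.
      apply Rmult_lt_compat_l with (r := s) in Ht; [|lra].
      replace (s * (ln eps / s)) with (ln eps) in Ht by (field; lra); lra. }
    unfold f; assert (0 < Rpower t s) by apply exp_pos; assert (0 < exp (- t)) by apply exp_pos.
    nra.
  - apply filterlim_locally; intros eps.
    set (M := exp (s * ln (2 * s))).
    assert (HM : 0 < M) by apply exp_pos.
    assert (He : 0 < eps) by apply cond_pos.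
    (* Beyond [2 ln (M / eps)] the bound [M exp (- t / 2)] is below [eps]. *)
    exists (Rmax 0 (2 * ln (M / eps))); intros t Ht.
    assert (Ht0 := Rle_lt_trans _ _ _ (Rmax_l _ _) Ht).
    assert (Ht1 := Rle_lt_trans _ _ _ (Rmax_r _ _) Ht).
    unfold ball in *; simpl in *; unfold AbsRing_ball, abs, minus, plus, opp in *; simpl in *.
    rewrite Ropp_0, Rplus_0_r, Rabs_pos_eq.
    2: unfold f; apply Rmult_le_pos; apply Rlt_le, exp_pos.
    apply Rle_lt_trans with (1 := Rpower_exp_le s t Hs Ht0); fold M.
    assert (Hlt : exp (ln (M / eps)) < exp (t / 2)) by (apply exp_increasing; lra).
    rewrite exp_ln in Hlt by now apply Rdiv_lt_0_compat.
    rewrite exp_Ropp; assert (0 < exp (t / 2)) by apply exp_pos.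
    apply Rmult_lt_reg_r with (exp (t / 2)); [assumption|].
    apply Rmult_lt_compat_r with (r := eps) in Hlt; [|assumption].
    replace (M * / exp (t / 2) * exp (t / 2)) with M by (field; lra).
    replace (M / eps * eps) with M in Hlt by (field; lra); lra. }
rewrite Rminus_0_r in HD.
assert (H1 := is_RInt_gen_minus _ _ _ _
   (is_RInt_gen_scal _ s _ (is_RInt_gen_Gamma s Hs))
   (is_RInt_gen_Gamma (s + 1) ltac:(lra))).
assert (H2 : is_RInt_gen (Derive f) (at_right 0) (Rbar_locally p_infty)
     (minus (scal s (Gamma s)) (Gamma (s + 1)))).
{ revert H1; apply is_RInt_gen_ext.
  revert Hord; apply filter_imp; intros [a b] H x; simpl in *.
  rewrite Rmin_left, Rmax_right by lra; intros Hx.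
  symmetry; apply is_derive_unique, Hd; lra. }
apply (@is_RInt_gen_unique R_CompleteNormedModule) in H2, HD; try typeclasses eauto.
rewrite H2 in HD; unfold minus, plus, opp, scal in HD; simpl in HD; unfold mult in HD; simpl in HD.
lra.
Qed.

Lemma Rpower_sub_mul_nonneg (u v p q : R) : 0 < u -> 0 < v -> 0 <= p -> 0 <= q ->
  0 <= (Rpower u p - Rpower v p) * (Rpower u q - Rpower v q).
Proof.
intros Hu Hv Hp Hq; destruct (Rle_lt_dec u v) as [H | H].
- assert (H1 := Rle_Rpower_l u v p Hp (conj Hu H)).
  assert (H2 := Rle_Rpower_l u v q Hq (conj Hu H)).
  nra.
- assert (H1 := Rle_Rpower_l v u p Hp ltac:(lra)).
  assert (H2 := Rle_Rpower_l v u q Hq ltac:(lra)).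
  nra.
Qed.

(* Chebyshev's correlation inequality for the increasing functions [t^p] and
   [t^q] under the weight [t^(x-1) exp (- t)]: the cut [t0] is chosen so that
   [t0^p] is the mean of [t^p]. *)
Lemma Gamma_mul_le (x p q : R) : 0 < x -> 0 < p -> 0 < q ->
  Gamma (x + p) * Gamma (x + q) <= Gamma (x + p + q) * Gamma x.
Proof.
intros Hx Hp Hq.
assert (G0 := Gamma_pos x Hx).
assert (Gp := Gamma_pos (x + p) ltac:(lra)).
set (t0 := Rpower (Gamma (x + p) / Gamma x) (/ p)).
assert (Ht0 : 0 < t0) by apply exp_pos.
assert (E : Rpower t0 p = Gamma (x + p) / Gamma x).
{ unfold t0; rewrite Rpower_mult, Rinv_l, Rpower_1; [reflexivity | now apply Rdiv_lt_0_compat | lra]. }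
assert (I1 := is_RInt_gen_Gamma (x + p + q) ltac:(lra)).
assert (I2 := is_RInt_gen_Gamma (x + p) ltac:(lra)).
assert (I3 := is_RInt_gen_Gamma (x + q) ltac:(lra)).
assert (HI := is_RInt_gen_plus _ _ _ _
  (is_RInt_gen_minus _ _ _ _ I1 (is_RInt_gen_scal _ (Rpower t0 q) _ I2))
  (is_RInt_gen_minus _ _ _ _
     (is_RInt_gen_scal _ (Rpower t0 (p + q)) _ (is_RInt_gen_Gamma x Hx))
     (is_RInt_gen_scal _ (Rpower t0 p) _ I3))).
match type of HI with is_RInt_gen ?f _ _ _ => set (g := f) in HI end.
assert (Eg : forall t, 0 < t -> g t =
  (Rpower t p - Rpower t0 p) * (Rpower t q - Rpower t0 q) * (Rpower t (x - 1) * exp (- t))).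
{ intros t Ht; unfold g, minus, plus, opp, scal; simpl; unfold mult; simpl.
  replace (x + p + q - 1) with (p + (q + (x - 1))) by ring.
  replace (x + p - 1) with (p + (x - 1)) by ring.
  replace (x + q - 1) with (q + (x - 1)) by ring.
  rewrite !Rpower_plus; ring. }
(* On the degenerate interval from 1 to 1 the comparison says that the whole integral of [g] is
   nonnegative. *)
assert (H := fun h1 h2 => RInt_le_is_RInt_gen_0_infty g _ 1 1 h1 h2 HI (conj Rlt_0_1 (Rle_refl 1))).
lapply H; clear H; [intros H; lapply H; clear H; [intros H|] |].
2:{  intros t Ht; apply @ex_derive_continuous.
    unfold g, minus, plus, opp, scal; simpl; unfold mult; simpl; unfold Rpower; auto_derive; lra. }
2:{ intros t Ht; rewrite Eg by exact Ht; apply Rmult_le_pos.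
  - apply Rpower_sub_mul_nonneg; lra.
  - apply Rmult_le_pos; apply Rlt_le, exp_pos. }
rewrite (@RInt_point R_CompleteNormedModule) in H; unfold minus, plus, opp, scal, zero in H; simpl in H.
unfold mult in H; simpl in H.
(* By the choice of [t0] the two terms containing [Rpower t0 q] cancel. *)
rewrite Rpower_plus, E in H.
apply Rmult_le_compat_l with (r := Gamma x) in H; [|lra].
replace (Gamma x * (Gamma (x + p + q) + - (Rpower t0 q * Gamma (x + p)) +
        (Gamma (x + p) / Gamma x * Rpower t0 q * Gamma x
         + - (Gamma (x + p) / Gamma x * Gamma (x + q)))))
  with (Gamma (x + p + q) * Gamma x - Gamma (x + p) * Gamma (x + q)) in H by (field; lra).
lra.
Qed.

(** * Gauss's summation theorem *)

Lemma sum_n_S (u : nat -> R) (n : nat) : sum_n u (S n) = sum_n u n + u (S n).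
Proof. exact (sum_Sn (G := R_AbelianMonoid) u n). Qed.

Lemma sum_n_nonneg (u : nat -> R) (n : nat) : (forall k, 0 <= u k) -> 0 <= sum_n u n.
Proof.
intros Hu; induction n as [|n IH]; [rewrite sum_O; apply Hu|].
rewrite sum_n_S; apply Rplus_le_le_0_compat; [exact IH | apply Hu].
Qed.

Lemma is_lim_seq_sum_n (u : nat -> R) :
  ex_series u -> is_lim_seq (sum_n u) (Series u).
Proof. exact (Series_correct u). Qed.

Lemma ex_series_nonneg_bounded (u : nat -> R) (M : R) :
  (forall n, 0 <= u n) -> (forall n, sum_n u n <= M) -> ex_series u.
Proof.
intros Hu HM.
destruct (ex_finite_lim_seq_incr (sum_n u) M) as [l Hl]; [| exact HM | now exists l].
intros n; rewrite sum_n_S; specialize (Hu (S n)); lra.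
Qed.

Lemma ex_series_abs_le (u g : nat -> R) :
  (forall n, Rabs (u n) <= g n) -> ex_series g -> ex_series u.
Proof. exact (@ex_series_le _ R_CompleteNormedModule u g). Qed.

Lemma Series_tail_le (u g : nat -> R) (K : nat) :
  (forall n, Rabs (u n) <= g n) -> ex_series g ->
  Rabs (Series u - sum_n u K) <= Series g - sum_n g K.
Proof.
intros Hug Hg.
assert (Hu := ex_series_abs_le u g Hug Hg).
assert (H : forall m, Rabs (sum_n u (m + K) - sum_n u K) <= sum_n g (m + K) - sum_n g K).
{ induction m as [|m IH].
  - simpl; rewrite !Rminus_diag, Rabs_R0; lra.
  - simpl; rewrite !sum_n_S.
    replace (sum_n u (m + K) + u (S (m + K)) - sum_n u K)
      with ((sum_n u (m + K) - sum_n u K) + u (S (m + K))) by ring.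
    eapply Rle_trans; [apply Rabs_triang|].
    specialize (Hug (S (m + K))); lra. }
assert (L : forall v, ex_series v ->
  is_lim_seq (fun m => sum_n v (m + K) - sum_n v K) (Series v - sum_n v K)).
{ intros v Hv; apply is_lim_seq_minus'; [|apply is_lim_seq_const].
  apply (is_lim_seq_incr_n (sum_n v) K (Series v)), is_lim_seq_sum_n, Hv. }
exact (is_lim_seq_le _ _ _ _ H (is_lim_seq_abs _ _ (L u Hu)) (L g Hg)).
Qed.

Lemma is_lim_seq_finite_sum (f : nat -> nat -> R) (h : nat -> R) :
  (forall k, is_lim_seq (fun N => f N k) (h k)) ->
  forall K, is_lim_seq (fun N => sum_n (f N) K) (sum_n h K).
Proof.
intros Hlim K; induction K as [|K IH].
- rewrite sum_O; apply is_lim_seq_ext with (2 := Hlim 0%nat); intros; now rewrite sum_O.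
- rewrite sum_n_S; apply is_lim_seq_ext with (fun N => sum_n (f N) K + f N (S K)).
  + intros; now rewrite sum_n_S.
  + now apply is_lim_seq_plus'.
Qed.

(** Tannery's theorem: one cut [K], chosen from the tail of [g], serves all the series at once, and
    the finite parts converge term by term. *)
Lemma Series_lim_dominated (f : nat -> nat -> R) (h g : nat -> R) :
  (forall N k, Rabs (f N k) <= g k) -> ex_series g ->
  (forall k, is_lim_seq (fun N => f N k) (h k)) ->
  is_lim_seq (fun N => Series (f N)) (Series h).
Proof.
intros Hf Hg Hlim.
assert (Hh : forall k, Rabs (h k) <= g k).
{ intros k; exact (is_lim_seq_le _ _ _ _ (fun N => Hf N k)
    (is_lim_seq_abs _ _ (Hlim k)) (is_lim_seq_const (g k))). }
assert (Hsum := is_lim_seq_finite_sum f h Hlim).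
apply is_lim_seq_spec; intros eps.
assert (He : 0 < eps / 4) by (destruct eps; simpl; lra).
destruct (proj2 (is_lim_seq_spec _ (Finite _)) (is_lim_seq_sum_n g Hg) (mkposreal _ He)) as [K HK].
specialize (HK K (le_n K)); simpl in HK.
destruct (proj2 (is_lim_seq_spec _ (Finite _)) (Hsum K) (mkposreal _ He)) as [N0 HN0].
exists N0; intros N HN; specialize (HN0 N HN); simpl in HN0.
assert (T1 := Series_tail_le (f N) g K (Hf N) Hg).
assert (T2 := Series_tail_le h g K Hh Hg).
apply Rabs_lt_between in HK; apply Rabs_lt_between in HN0.
apply Rabs_le_between in T1; apply Rabs_le_between in T2.
apply Rabs_lt_between; lra.
Qed.

(** As for the harmonic series: if [l > 0], the terms are at least [l / n], and each block from [m]
    to [2 m] adds at least [l / 2] to a convergent sum. *)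
Lemma series_inv_bound (u : nat -> R) (l : R) (n0 : nat) :
  (forall n, 0 <= u n) -> ex_series u ->
  (forall n, (n0 <= n)%nat -> l <= INR n * u n) -> l <= 0.
Proof.
intros Hu Hex Hl; apply Rnot_lt_le; intros Hpos.
assert (H : forall N m, (n0 <= N)%nat -> (0 < N)%nat ->
   sum_n u N + INR m * (l / INR (N + m)) <= sum_n u (N + m)).
{ intros N m HN HN0; induction m as [|m IH].
  - rewrite Nat.add_0_r; simpl; lra.
  - rewrite Nat.add_succ_r, sum_n_S.
    assert (HS := Hl (S (N + m)) ltac:(lia)).
    assert (P1 : 0 < INR (N + m)) by (apply lt_0_INR; lia).
    rewrite S_INR in HS; rewrite !S_INR.
    assert (l / (INR (N + m) + 1) <= u (S (N + m))).
    { apply Rmult_le_reg_r with (INR (N + m) + 1); [lra|].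
      unfold Rdiv; rewrite Rmult_assoc, Rinv_l by lra; lra. }
    assert (l / (INR (N + m) + 1) <= l / INR (N + m)).
    { apply Rmult_le_compat_l; [lra|]; apply Rinv_le_contravar; lra. }
    assert (0 <= INR m) by apply pos_INR.
    nra. }
assert (L := is_lim_seq_sum_n u Hex).
assert (H2 : forall N, sum_n u (N + S n0) + l / 2 <= sum_n u (N + S n0 + (N + S n0))).
{ intros N; set (m := (N + S n0)%nat).
  assert (Hm : 0 < INR m) by (apply lt_0_INR; unfold m; lia).
  assert (HN := H m m ltac:(unfold m; lia) ltac:(unfold m; lia)).
  rewrite plus_INR in HN.
  replace (INR m * (l / (INR m + INR m))) with (l / 2) in HN by (field; lra).
  exact HN. }
assert (L1 : is_lim_seq (fun N => sum_n u (N + S n0) + l / 2) (Series u + l / 2)).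
{ apply is_lim_seq_plus'; [|apply is_lim_seq_const].
  now apply (is_lim_seq_incr_n (sum_n u) (S n0) (Series u)). }
assert (L2 : is_lim_seq (fun N => sum_n u (N + S n0 + (N + S n0))) (Series u)).
{ apply (is_lim_seq_subseq (sum_n u) (Series u) (fun N => (N + S n0 + (N + S n0))%nat)); [|exact L].
  intros P [N0 HP]; exists N0; intros n Hn; apply HP; lia. }
assert (HH := is_lim_seq_le _ _ _ _ H2 L1 L2); simpl in HH; lra.
Qed.

(** * Pochhammer symbols and the Gauss series at 1 *)

Lemma R_poch_pos (x : R) (n : nat) : 0 < x -> 0 < R_poch x n.
Proof.
intros Hx; induction n as [|n IH]; simpl; [lra|].
apply Rmult_lt_0_compat; [exact IH|]; assert (H := pos_INR n); lra.
Qed.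

Lemma R_poch_add (x : R) (m n : nat) :
  R_poch x (m + n) = R_poch x m * R_poch (x + INR m) n.
Proof.
induction n as [|n IH]; [rewrite Nat.add_0_r; simpl; ring|].
rewrite Nat.add_succ_r; simpl; rewrite IH, plus_INR; ring.
Qed.

Lemma R_poch_S_l (x : R) (n : nat) : R_poch x (S n) = x * R_poch (x + 1) n.
Proof. change (S n) with (1 + n)%nat; rewrite R_poch_add; simpl; ring. Qed.

Lemma R_poch_le (x y : R) (n : nat) : 0 < x <= y -> R_poch x n <= R_poch y n.
Proof.
intros Hxy; induction n as [|n IH]; simpl; [lra|].
assert (H := pos_INR n); assert (H1 := R_poch_pos x n ltac:(lra)).
apply Rmult_le_compat; lra.
Qed.

Lemma Gamma_add_nat (x : R) (n : nat) : 0 < x -> Gamma (x + INR n) = R_poch x n * Gamma x.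
Proof.
intros Hx; induction n as [|n IH]; [simpl; rewrite Rplus_0_r; ring|].
rewrite S_INR, <- Rplus_assoc, Gamma_succ, IH; [simpl; ring|].
assert (H := pos_INR n); lra.
Qed.

Definition gauss_term (a b c : R) (n : nat) : R :=
  R_poch a n * R_poch b n / (R_poch c n * R_poch 1 n).

Lemma gauss_term_pos (a b c : R) (n : nat) :
  0 < a -> 0 < b -> 0 < c -> 0 < gauss_term a b c n.
Proof.
intros; unfold gauss_term; apply Rdiv_lt_0_compat;
  apply Rmult_lt_0_compat; apply R_poch_pos; lra.
Qed.

Lemma gauss_term_S (a b c : R) (n : nat) : 0 < c ->
  gauss_term a b c (S n) =
  gauss_term a b c n * ((a + INR n) * (b + INR n) / ((c + INR n) * (1 + INR n))).
Proof.
intros Hc; assert (H := pos_INR n).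
assert (H1 := R_poch_pos c n Hc); assert (H2 := R_poch_pos 1 n Rlt_0_1).
unfold gauss_term; simpl; field; repeat split; lra.
Qed.

Section GaussSummation.

Variables a b : R.
Hypotheses (ha : 0 < a) (hb : 0 < b).

(** Kummer's convergence test with multipliers [n]: a telescoping difference is compared with the
    term itself. *)
Lemma gauss_term_kummer (c : R) (n : nat) : 0 < c ->
  INR n * gauss_term a b c n - INR (S n) * gauss_term a b c (S n) =
  gauss_term a b c n * ((INR n * (c - a - b) - a * b) / (c + INR n)).
Proof.
intros Hc; rewrite gauss_term_S, S_INR by exact Hc; assert (H := pos_INR n).
field; lra.
Qed.

(** The factor in [gauss_term_kummer] tends to [c - a - b > 0], hence eventually exceeds half of
    it. *)
Lemma gauss_term_kummer_ge (c : R) : a + b < c ->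
  exists n0 : nat, forall n, (n0 <= n)%nat ->
    (c - a - b) / 2 * gauss_term a b c n <=
    INR n * gauss_term a b c n - INR (S n) * gauss_term a b c (S n).
Proof.
intros Hc.
destruct (nfloor_ex (2 * (a * b + c) / (c - a - b) + c)) as [n0 Hn0].
{ assert (0 < 2 * (a * b + c) / (c - a - b)) by (apply Rdiv_lt_0_compat; nra). lra. }
exists (S n0); intros n Hn; apply le_INR in Hn; rewrite S_INR in Hn.
rewrite gauss_term_kummer, (Rmult_comm _ (gauss_term _ _ _ _)) by lra.
apply Rmult_le_compat_l; [apply Rlt_le, gauss_term_pos; lra|].
assert (H := pos_INR n).
apply Rmult_le_reg_r with (c + INR n); [lra|].
replace ((INR n * (c - a - b) - a * b) / (c + INR n) * (c + INR n))
  with (INR n * (c - a - b) - a * b) by (field; lra).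
assert (H1 : 2 * (a * b + c) / (c - a - b) + c < INR n) by lra.
apply Rmult_lt_compat_r with (r := c - a - b) in H1; [|lra].
replace ((2 * (a * b + c) / (c - a - b) + c) * (c - a - b))
  with (2 * (a * b + c) + c * (c - a - b)) in H1 by (field; lra).
lra.
Qed.

Lemma ex_series_gauss (c : R) : a + b < c -> ex_series (gauss_term a b c).
Proof.
intros Hc; destruct (gauss_term_kummer_ge c Hc) as [n0 Hn0].
apply (ex_series_incr_n (gauss_term a b c) n0).
set (v := fun n => INR n * gauss_term a b c n).
assert (Hv : forall n, 0 <= v n).
{ intros n; apply Rmult_le_pos; [apply pos_INR | apply Rlt_le, gauss_term_pos; lra]. }
apply ex_series_nonneg_bounded with (2 / (c - a - b) * v n0).
- intros; apply Rlt_le, gauss_term_pos; lra.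
- assert (H : forall m, (c - a - b) / 2 * sum_n (fun k => gauss_term a b c (n0 + k)) m
     <= v n0 - v (n0 + S m)%nat).
  { induction m as [|m IH].
    - rewrite sum_O, Nat.add_0_r, Nat.add_1_r; apply Hn0; lia.
    - rewrite sum_n_S, Rmult_plus_distr_l.
      rewrite (Nat.add_succ_r n0 (S m)).
      assert (H := Hn0 (n0 + S m)%nat ltac:(lia)); fold (v (n0 + S m)%nat) in H.
      fold (v (S (n0 + S m))) in H; lra. }
  intros m; specialize (H m); specialize (Hv (n0 + S m)%nat).
  apply Rmult_le_reg_l with ((c - a - b) / 2); [lra|].
  replace ((c - a - b) / 2 * (2 / (c - a - b) * v n0)) with (v n0) by (field; lra).
  lra.
Qed.

(** The sequence is eventually decreasing and nonnegative, hence has a limit; a positive limit would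
    make the Gauss series diverge like the harmonic one. *)
Lemma lim_mul_gauss_term (c : R) : a + b < c ->
  is_lim_seq (fun n => INR n * gauss_term a b c n) 0.
Proof.
intros Hc; destruct (gauss_term_kummer_ge c Hc) as [n0 Hn0].
set (v := fun n => INR n * gauss_term a b c n).
assert (Hv : forall n, 0 <= v n).
{ intros n; apply Rmult_le_pos; [apply pos_INR | apply Rlt_le, gauss_term_pos; lra]. }
assert (Hdec : forall k, v (S k + n0)%nat <= v (k + n0)%nat).
{ intros k; assert (H := Hn0 (k + n0)%nat ltac:(lia)).
  fold (v (k + n0)%nat) in H; fold (v (S (k + n0))) in H; simpl.
  assert (H1 := gauss_term_pos a b c (k + n0) ha hb ltac:(lra)).
  assert (0 <= (c - a - b) / 2 * gauss_term a b c (k + n0)) by (apply Rmult_le_pos; lra).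
  lra. }
destruct (ex_finite_lim_seq_decr (fun k => v (k + n0)%nat) 0) as [l Hl].
- exact Hdec.
- intros; apply Hv.
- assert (Hge : forall n, (n0 <= n)%nat -> l <= v n).
  { intros n Hn; replace n with ((n - n0) + n0)%nat by lia.
    apply (is_lim_seq_decr_compare (fun k => v (k + n0)%nat) l Hl Hdec). }
  assert (Hl0 : l <= 0).
  { apply series_inv_bound with (gauss_term a b c) n0; [| now apply ex_series_gauss | exact Hge].
    intros; apply Rlt_le, gauss_term_pos; lra. }
  assert (0 <= l).
  { exact (is_lim_seq_le _ _ 0 l (fun k => Hv (k + n0)%nat) (is_lim_seq_const 0) Hl). }
  replace 0 with l by lra.
  now apply (is_lim_seq_incr_n v n0 l).
Qed.

Definition gauss_sum (c : R) : R := Series (gauss_term a b c).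

Lemma gauss_term_c_succ (c : R) (n : nat) : 0 < c ->
  gauss_term a b (c + 1) n = gauss_term a b c n * (c / (c + INR n)).
Proof.
intros Hc; assert (H := pos_INR n).
assert (E := R_poch_S_l c n); simpl in E.
assert (H1 := R_poch_pos c n Hc); assert (H2 := R_poch_pos 1 n Rlt_0_1).
assert (H3 := R_poch_pos (c + 1) n ltac:(lra)).
unfold gauss_term.
replace (R_poch (c + 1) n) with (R_poch c n * (c + INR n) / c) by (rewrite E; field; lra).
field; repeat split; lra.
Qed.

(** Term by term, the difference of the two sides is [c] times the telescoping difference of
    [gauss_term_kummer], whose boundary term tends to 0. *)
Lemma gauss_sum_contiguous (c : R) : a + b < c ->
  c * (c - a - b) * gauss_sum c = (c - a) * (c - b) * gauss_sum (c + 1).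
Proof.
intros Hc.
set (w := fun n => c * (c - a - b) * gauss_term a b c n
                   - (c - a) * (c - b) * gauss_term a b (c + 1) n).
assert (E1 := ex_series_gauss c Hc).
assert (E2 := ex_series_gauss (c + 1) ltac:(lra)).
assert (Hw : Series w = c * (c - a - b) * gauss_sum c - (c - a) * (c - b) * gauss_sum (c + 1)).
{ unfold w, gauss_sum.
  rewrite Series_minus, !Series_scal_l; [reflexivity | |]; now apply @ex_series_scal_l. }
assert (Hsum : forall N, sum_n w N = - c * (INR (S N) * gauss_term a b c (S N)) :> R).
{ assert (Hstep : forall n, w n = c * (INR n * gauss_term a b c n - INR (S n) * gauss_term a b c (S n))).
  { intros n; unfold w; rewrite gauss_term_kummer, gauss_term_c_succ by lra.
    assert (H := pos_INR n); field; lra. }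
  induction N as [|N IH].
  - rewrite sum_O, Hstep; simpl; ring.
  - rewrite sum_n_S, IH, Hstep; ring. }
assert (L : is_series w 0).
{ change (is_lim_seq (sum_n w) 0).
  apply (is_lim_seq_ext (fun N => - c * (INR (S N) * gauss_term a b c (S N)))); [now intros|].
  replace (Finite 0) with (Rbar_mult (- c) 0) by (simpl; f_equal; ring).
  apply is_lim_seq_scal_l, (is_lim_seq_incr_1 (fun n => INR n * gauss_term a b c n)).
  now apply lim_mul_gauss_term. }
apply is_series_unique in L; lra.
Qed.

Lemma gauss_sum_ge_1 (c : R) : a + b < c -> 1 <= gauss_sum c.
Proof.
intros Hc; unfold gauss_sum; rewrite Series_incr_1 by now apply ex_series_gauss.
assert (0 <= Series (fun k => gauss_term a b c (S k))).
{ rewrite <- (Rmult_0_l (Series (fun k => gauss_term a b c (S k)))), <- Series_scal_l.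
  apply Series_le.
  - intros n; assert (H := gauss_term_pos a b c (S n) ha hb ltac:(lra)); lra.
  - now apply (ex_series_incr_1 (gauss_term a b c)), ex_series_gauss. }
unfold gauss_term at 1; simpl; lra.
Qed.

(** Only the first factor of [(c + d)_(n+1)] is compared precisely; this already gains [c / (c + d)]
    on every term but the first, so the sum tends to 1 as [d] grows. *)
Lemma gauss_sum_shift_le (c d : R) : a + b < c -> 0 <= d ->
  gauss_sum (c + d) <= 1 + c / (c + d) * (gauss_sum c - 1).
Proof.
intros Hc Hd; unfold gauss_sum.
rewrite (Series_incr_1 (gauss_term a b (c + d))), (Series_incr_1 (gauss_term a b c))
  by (apply ex_series_gauss; lra).
replace (gauss_term a b (c + d) 0) with 1 by (unfold gauss_term; simpl; field).
replace (gauss_term a b c 0) with 1 by (unfold gauss_term; simpl; field).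
replace (1 + Series (fun k => gauss_term a b c (S k)) - 1)
  with (Series (fun k => gauss_term a b c (S k))) by ring.
apply Rplus_le_compat_l; rewrite <- Series_scal_l.
apply Series_le.
2:{ apply (@ex_series_scal_l _ R_NormedModule), (ex_series_incr_1 (gauss_term a b c)).
    now apply ex_series_gauss. }
intros n; split; [apply Rlt_le, gauss_term_pos; lra|].
unfold gauss_term; rewrite (R_poch_S_l (c + d)), (R_poch_S_l c).
assert (H0 := R_poch_pos (c + 1) n ltac:(lra)).
assert (H1 := R_poch_pos (c + d + 1) n ltac:(lra)).
assert (H2 := R_poch_pos 1 (S n) Rlt_0_1).
assert (H3 := R_poch_le (c + 1) (c + d + 1) n ltac:(lra)).
assert (H4 := R_poch_pos a (S n) ha).
assert (H5 := R_poch_pos b (S n) hb).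
replace (c / (c + d) * (R_poch a (S n) * R_poch b (S n) / (c * R_poch (c + 1) n * R_poch 1 (S n))))
  with (R_poch a (S n) * R_poch b (S n) / ((c + d) * R_poch (c + 1) n * R_poch 1 (S n)))
  by (field; repeat split; lra).
apply Rmult_le_compat_l; [apply Rmult_le_pos; lra|].
apply Rinv_le_contravar.
- apply Rmult_lt_0_compat; [apply Rmult_lt_0_compat; lra | lra].
- apply Rmult_le_compat_r; [lra|]; apply Rmult_le_compat_l; lra.
Qed.

Definition gauss_value (c : R) : R :=
  Gamma c * Gamma (c - a - b) / (Gamma (c - a) * Gamma (c - b)).

Lemma gauss_value_contiguous (c : R) : a + b < c ->
  c * (c - a - b) * gauss_value c = (c - a) * (c - b) * gauss_value (c + 1).
Proof.
intros Hc; unfold gauss_value.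
replace (c + 1 - a - b) with (c - a - b + 1) by ring.
replace (c + 1 - a) with (c - a + 1) by ring.
replace (c + 1 - b) with (c - b + 1) by ring.
rewrite !Gamma_succ by lra.
assert (H1 := Gamma_pos (c - a) ltac:(lra)).
assert (H2 := Gamma_pos (c - b) ltac:(lra)).
field; repeat split; lra.
Qed.

Lemma gauss_value_ge_1 (c : R) : a + b < c -> 1 <= gauss_value c.
Proof.
intros Hc; unfold gauss_value.
assert (H1 := Gamma_pos (c - a) ltac:(lra)).
assert (H2 := Gamma_pos (c - b) ltac:(lra)).
assert (H := Gamma_mul_le (c - a - b) b a ltac:(lra) hb ha).
replace (c - a - b + b + a) with c in H by ring.
replace (c - a - b + b) with (c - a) in H by ring.
replace (c - a - b + a) with (c - b) in H by ring.
apply Rmult_le_reg_r with (Gamma (c - a) * Gamma (c - b)); [now apply Rmult_lt_0_compat|].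
replace (Gamma c * Gamma (c - a - b) / (Gamma (c - a) * Gamma (c - b)) * (Gamma (c - a) * Gamma (c - b)))
  with (Gamma c * Gamma (c - a - b)) by (field; lra).
lra.
Qed.

Lemma R_poch_ratio_le (x : R) (k : nat) : 0 < x ->
  R_poch (x + b) k <= (1 + b / x) ^ k * R_poch x k.
Proof.
intros Hx; induction k as [|k IH]; simpl; [lra|].
assert (H := pos_INR k).
assert (H1 := R_poch_pos (x + b) k ltac:(lra)).
assert (Hbx : 0 < b / x) by now apply Rdiv_lt_0_compat.
replace ((1 + b / x) * (1 + b / x) ^ k * (R_poch x k * (x + INR k)))
  with (((1 + b / x) ^ k * R_poch x k) * ((1 + b / x) * (x + INR k))) by ring.
apply Rmult_le_compat; [lra | lra | exact IH |].
replace ((1 + b / x) * (x + INR k)) with (x + INR k + b + b / x * INR k) by (field; lra).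
assert (0 <= b / x * INR k) by (apply Rmult_le_pos; lra).
lra.
Qed.

(** The correlation inequality with base [c - b] and increments [b] and [k - a] turns the Gamma
    quotient into [(x + b)_k / (x)_k] with [x = c - a - b]. With [k] fixed, the bound tends to 1 as
    [c] grows. *)
Lemma gauss_value_le (c : R) (k : nat) : a + b < c -> a < INR k ->
  gauss_value c <= (1 + b / (c - a - b)) ^ k.
Proof.
intros Hc Hk; unfold gauss_value.
assert (H1 := Gamma_pos (c - a) ltac:(lra)).
assert (H2 := Gamma_pos (c - b) ltac:(lra)).
assert (H3 := Gamma_pos (c - a - b) ltac:(lra)).
set (x := c - a - b) in *.
assert (H := Gamma_mul_le (x + a) b (INR k - a) ltac:(unfold x; lra) hb ltac:(lra)).
replace (x + a + b) with c in H by (unfold x; ring).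
replace (c + (INR k - a)) with (x + b + INR k) in H by (unfold x; ring).
replace (x + a + (INR k - a)) with (x + INR k) in H by (unfold x; ring).
replace (x + a) with (c - b) in H by (unfold x; ring).
rewrite !Gamma_add_nat in H by (unfold x; lra).
replace (x + b) with (c - a) in H at 2 by (unfold x; ring).
assert (HP := R_poch_pos x k ltac:(unfold x; lra)).
assert (HR := R_poch_ratio_le x k ltac:(unfold x; lra)).
apply Rmult_le_reg_r with (Gamma (c - a) * Gamma (c - b)); [now apply Rmult_lt_0_compat|].
replace (Gamma c * Gamma x / (Gamma (c - a) * Gamma (c - b)) * (Gamma (c - a) * Gamma (c - b)))
  with (Gamma c * Gamma x) by (field; lra).
apply Rmult_le_reg_l with (R_poch x k); [exact HP|].
apply Rle_trans with (R_poch (x + b) k * Gamma (c - a) * Gamma (c - b)); [lra|].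
apply Rle_trans with ((1 + b / x) ^ k * R_poch x k * Gamma (c - a) * Gamma (c - b)); [|right; ring].
apply Rmult_le_compat_r; [lra|]; apply Rmult_le_compat_r; lra.
Qed.

Lemma is_lim_seq_inv_shift (u v : R) : is_lim_seq (fun N => u / (v + INR N)) 0.
Proof.
assert (H : is_lim_seq (fun N => v + INR N) p_infty).
{ eapply is_lim_seq_plus; [apply is_lim_seq_const | apply is_lim_seq_INR | reflexivity]. }
apply is_lim_seq_inv in H; [|discriminate].
apply (is_lim_seq_scal_l _ u) in H; simpl in H; rewrite Rmult_0_r in H.
exact H.
Qed.

(** The common recurrence in [c] makes the ratio of the two sides invariant under [c -> c + 1], and
    both sides tend to 1 along [c + N]. *)
Lemma gauss_summation (c : R) : a + b < c -> gauss_sum c = gauss_value c.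
Proof.
intros Hc.
assert (Hratio : forall N, gauss_value (c + INR N) * gauss_sum c = gauss_value c * gauss_sum (c + INR N)).
{ induction N as [|N IH]; [simpl; rewrite Rplus_0_r; ring|].
  assert (H := pos_INR N).
  assert (C1 := gauss_sum_contiguous (c + INR N) ltac:(lra)).
  assert (C2 := gauss_value_contiguous (c + INR N) ltac:(lra)).
  rewrite S_INR, <- Rplus_assoc.
  set (d := c + INR N) in *.
  assert (Hd : 0 < (d - a) * (d - b)) by (apply Rmult_lt_0_compat; unfold d; lra).
  apply Rmult_eq_reg_l with ((d - a) * (d - b)); [|lra].
  rewrite <- !Rmult_assoc, <- C2.
  replace ((d - a) * (d - b) * gauss_value c * gauss_sum (d + 1))
    with (gauss_value c * ((d - a) * (d - b) * gauss_sum (d + 1))) by ring.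
  rewrite <- C1.
  replace (d * (d - a - b) * gauss_value d * gauss_sum c)
    with (d * (d - a - b) * (gauss_value d * gauss_sum c)) by ring.
  rewrite IH; ring. }
assert (L1 : is_lim_seq (fun N => gauss_sum (c + INR N)) 1).
{ apply is_lim_seq_le_le with (fun _ => 1) (fun N => 1 + c / (c + INR N) * (gauss_sum c - 1)).
  - intros N; assert (H := pos_INR N); split; [apply gauss_sum_ge_1; lra|].
    apply gauss_sum_shift_le; lra.
  - apply is_lim_seq_const.
  - replace (Finite 1) with (Finite (1 + 0 * (gauss_sum c - 1))) by (f_equal; ring).
    apply is_lim_seq_plus'; [apply is_lim_seq_const|].
    apply is_lim_seq_mult'; [apply is_lim_seq_inv_shift | apply is_lim_seq_const]. }
assert (L2 : is_lim_seq (fun N => gauss_value (c + INR N)) 1).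
{ destruct (nfloor_ex a ltac:(lra)) as [k Hk].
  apply is_lim_seq_le_le with (fun _ => 1) (fun N => (1 + b / (c - a - b + INR N)) ^ S k).
  - intros N; assert (H := pos_INR N); split; [apply gauss_value_ge_1; lra|].
    replace (c - a - b + INR N) with (c + INR N - a - b) by ring.
    apply gauss_value_le; [lra | rewrite S_INR; lra].
  - apply is_lim_seq_const.
  - replace (Finite 1) with (Finite ((1 + 0) ^ S k)) by (f_equal; rewrite Rplus_0_r, pow1; reflexivity).
    apply (is_lim_seq_continuous (fun y => y ^ S k)).
    + apply derivable_continuous_pt, derivable_pt_pow.
    + apply is_lim_seq_plus'; [apply is_lim_seq_const | apply is_lim_seq_inv_shift]. }
assert (L3 := is_lim_seq_mult' _ _ _ _ L2 (is_lim_seq_const (gauss_sum c))).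
assert (L4 := is_lim_seq_mult' _ _ _ _ (is_lim_seq_const (gauss_value c)) L1).
apply (is_lim_seq_ext _ _ _ Hratio) in L3.
apply is_lim_seq_unique in L3; apply is_lim_seq_unique in L4.
rewrite L3 in L4; injection L4; lra.
Qed.

End GaussSummation.

(** * The Clausen sum at 1 *)

Local Ltac real_eq := match goal with |- ?x = ?y => change (x = y :> R) end.

(** * Rearrangements of finite sums and series *)

Lemma sum_n_S_l (u : nat -> R) (n : nat) :
  sum_n u (S n) = u 0%nat + sum_n (fun k => u (S k)) n :> R.
Proof.
induction n as [|n IH].
- rewrite sum_n_S, !sum_O; reflexivity.
- rewrite sum_n_S, IH, sum_n_S; ring.
Qed.

Lemma sum_n_plus_R (u v : nat -> R) (n : nat) :
  sum_n (fun k => u k + v k) n = sum_n u n + sum_n v n :> R.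
Proof. exact (sum_n_plus (G := R_AbelianMonoid) u v n). Qed.

Lemma sum_n_scal_R (x : R) (u : nat -> R) (n : nat) :
  sum_n (fun k => x * u k) n = x * sum_n u n :> R.
Proof. exact (sum_n_mult_l (K := R_Ring) x u n). Qed.

Lemma sum_n_triangle (d : nat -> nat -> R) (N : nat) :
  sum_n (fun n => sum_n (fun k => d k (n - k)%nat) n) N =
  sum_n (fun k => sum_n (d k) (N - k)) N :> R.
Proof.
induction N as [|N IH].
- now rewrite !sum_O.
- rewrite (sum_n_S _ N), IH, !(sum_n_S _ N), Nat.sub_diag, sum_O.
  rewrite <- Rplus_assoc; f_equal; rewrite <- sum_n_plus_R.
  apply sum_n_ext_loc; intros k Hk.
  now rewrite (Nat.sub_succ_l k N Hk), sum_n_S.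
Qed.

Lemma Series_finite (u : nat -> R) (N : nat) :
  (forall k, (N < k)%nat -> u k = 0) -> Series u = sum_n u N.
Proof.
intros Hu; apply is_series_unique.
apply (is_lim_seq_incr_n (sum_n u) N (sum_n u N)).
apply is_lim_seq_ext with (2 := is_lim_seq_const (sum_n u N)).
induction n as [|n IH]; [reflexivity|].
simpl; rewrite sum_n_S, <- IH, (Hu (S (n + N))) by lia.
  symmetry; apply Rplus_0_r.
Qed.

Lemma sum_n_le_Series (u : nat -> R) (n : nat) :
  (forall k, 0 <= u k) -> ex_series u -> sum_n u n <= Series u.
Proof.
intros Hu Hex; assert (L := is_lim_seq_sum_n u Hex).
apply (is_lim_seq_incr_compare (sum_n u) (Series u) L).
intros k; rewrite sum_n_S; specialize (Hu (S k)); lra.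
Qed.

Lemma is_series_even (w : nat -> R) (s : R) :
  (forall m, w (S (2 * m)) = 0) -> is_series w s ->
  is_series (fun m => w (2 * m)%nat) s.
Proof.
intros Hodd Hw.
assert (E : forall m, sum_n w (2 * m) = sum_n (fun m => w (2 * m)%nat) m :> R).
{ induction m as [|m IH]; [now rewrite !sum_O|].
  replace (2 * S m)%nat with (S (S (2 * m))) by lia.
  rewrite !sum_n_S, IH, Hodd.
  replace (2 * S m)%nat with (S (S (2 * m))) by lia; ring. }
change (is_lim_seq (sum_n (fun m => w (2 * m)%nat)) s).
apply is_lim_seq_ext with (1 := E).
apply (is_lim_seq_subseq (sum_n w) s (fun m => (2 * m)%nat)); [|exact Hw].
intros P [N HN]; exists N; intros n Hn; apply HN; lia.
Qed.

(* Coefficients of [(1 - t)^(- a)]. *)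
Definition binom_coeff (a : R) (k : nat) : R := R_poch a k / R_poch 1 k.

Lemma binom_coeff_S (a : R) (k : nat) :
  INR (S k) * binom_coeff a (S k) = (INR k + a) * binom_coeff a k.
Proof.
unfold binom_coeff; rewrite S_INR; simpl.
assert (H := pos_INR k); assert (H1 := R_poch_pos 1 k Rlt_0_1); field; lra.
Qed.

Lemma binom_coeff_pos (a : R) (k : nat) : 0 < a -> 0 < binom_coeff a k.
Proof. intros Ha; apply Rdiv_lt_0_compat; apply R_poch_pos; lra. Qed.

Lemma binom_coeff_0 (a : R) : binom_coeff a 0 = 1.
Proof. unfold binom_coeff; simpl; field. Qed.

(* Coefficients of [(1 - t)^(- a) (1 - x t)^(- a)]. *)
Definition mixed_coeff (a x : R) (n : nat) : R :=
  sum_n (fun k => binom_coeff a k * x ^ k * binom_coeff a (n - k)) n.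

Lemma mixed_coeff_0 (a x : R) : mixed_coeff a x 0 = 1.
Proof. unfold mixed_coeff; rewrite sum_O; simpl; rewrite binom_coeff_0; ring. Qed.

Lemma mixed_coeff_1 (a x : R) : mixed_coeff a x 1 = a * (1 + x).
Proof.
unfold mixed_coeff; rewrite sum_n_S, sum_O; simpl.
unfold binom_coeff; simpl; field.
Qed.

(* [U] and [V] below are the coefficients of [t A'(t) B(t)] and
   [t A(t) B'(t)] for [A = (1 - t)^(- a)] and [B = (1 - x t)^(- a)]. *)
Lemma mixed_coeff_rec (a x : R) (n : nat) :
  INR (S (S n)) * mixed_coeff a x (S (S n)) =
  (1 + x) * (INR (S n) + a) * mixed_coeff a x (S n)
  - x * (INR n + 2 * a) * mixed_coeff a x n.
Proof.
set (al := binom_coeff a).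
set (q := mixed_coeff a x).
set (U := fun n => sum_n (fun k => INR (n - k) * al (n - k)%nat * (al k * x ^ k)) n : R).
set (V := fun n => sum_n (fun k => INR k * al k * x ^ k * al (n - k)%nat) n : R).
(* [HUV] is the product rule for [t d/dt]; [HU] and [HV] below express [(1 - t) A' = a A] and
   [(1 - x t) B' = a x B]. *)
assert (HUV : forall n, INR n * q n = U n + V n).
{ intros m; unfold q, mixed_coeff, U, V; fold al.
  rewrite <- sum_n_scal_R, <- sum_n_plus_R.
  apply sum_n_ext_loc; intros k Hk.
  rewrite minus_INR by exact Hk; simpl; ring. }
assert (HU : forall n, U (S n) = U n + a * q n).
{ intros m; unfold q, mixed_coeff, U; fold al.
  rewrite sum_n_S, Nat.sub_diag, <- sum_n_scal_R, <- sum_n_plus_R.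
  simpl (INR 0); rewrite !Rmult_0_l, Rplus_0_r.
  apply sum_n_ext_loc; intros k Hk.
  rewrite (Nat.sub_succ_l k m Hk); unfold al; rewrite binom_coeff_S; simpl; ring. }
assert (HV : forall n, V (S n) = x * (V n + a * q n)).
{ intros m; unfold q, mixed_coeff, V; fold al.
  rewrite sum_n_S_l, <- sum_n_scal_R, <- sum_n_plus_R, <- sum_n_scal_R.
  simpl (INR 0); rewrite !Rmult_0_l, Rplus_0_l.
  apply sum_n_ext_loc; intros k Hk.
  rewrite Nat.sub_succ; unfold al; rewrite binom_coeff_S; simpl; ring. }
rewrite (HUV (S (S n))), (HU (S n)), (HV (S n)).
assert (E1 := HUV (S n)); rewrite HU, HV in E1.
assert (E0 := HUV n).
replace ((1 + x) * (INR (S n) + a) * q (S n)) with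
  ((1 + x) * (INR (S n) * q (S n)) + (1 + x) * a * q (S n)) by ring.
rewrite E1.
replace (x * (INR n + 2 * a) * q n) with (x * (INR n * q n) + 2 * a * x * q n) by ring.
rewrite E0, HU, HV; ring.
Qed.

(* For [-1 <= x <= 0] the recurrence has nonnegative coefficients. *)
Lemma mixed_coeff_bounds (a a' y : R) (n : nat) :
  0 < a <= a' -> 1 <= a' -> 0 <= y <= 1 ->
  0 <= mixed_coeff a (- y) n <= binom_coeff a' n.
Proof.
intros Ha Ha' Hy.
enough (H : 0 <= mixed_coeff a (- y) n <= binom_coeff a' n /\
            0 <= mixed_coeff a (- y) (S n) <= binom_coeff a' (S n)) by apply H.
induction n as [|n [[IHl0 IHr0] [IHl1 IHr1]]].
- rewrite mixed_coeff_0, mixed_coeff_1, binom_coeff_0.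
  replace (binom_coeff a' 1) with a' by (unfold binom_coeff; simpl; field).
  split; nra.
- split; [easy|].
  assert (R0 := mixed_coeff_rec a (- y) n).
  assert (B1 := binom_coeff_S a' (S n)).
  assert (B0 := binom_coeff_S a' n).
  set (q0 := mixed_coeff a (- y) n) in *.
  set (q1 := mixed_coeff a (- y) (S n)) in *.
  set (q2 := mixed_coeff a (- y) (S (S n))) in *.
  set (r0 := binom_coeff a' n) in *.
  set (r1 := binom_coeff a' (S n)) in *.
  set (r2 := binom_coeff a' (S (S n))) in *.
  rewrite !S_INR in *; assert (H := pos_INR n); set (m := INR n) in *.
  (* The recurrence at [x = - y] mixes two terms with weights [1 - y] and [y], so each is bounded
     separately by [(m + 1 + a') r1]. For the second one the gap is [a' (a' - 1)], up to a
     nonnegative factor: here [1 <= a'] enters. *)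
  assert (Hr : (m + 2 * a') * r0 <= (m + 1 + a') * r1).
  { apply Rmult_le_reg_l with (m + 1); [lra|].
    replace ((m + 1) * ((m + 1 + a') * r1)) with ((m + 1 + a') * ((m + 1) * r1)) by ring.
    rewrite B0.
    assert (0 <= (a' * (a' - 1)) * r0) by (apply Rmult_le_pos; [apply Rmult_le_pos|]; lra).
    lra. }
  assert (T1 : 0 <= (1 - y) * ((m + 1 + a) * q1) <= (1 - y) * ((m + 1 + a') * r1)).
  { split; [repeat apply Rmult_le_pos; lra|].
    apply Rmult_le_compat_l; [lra|]; apply Rmult_le_compat; lra. }
  assert (T2 : 0 <= y * ((m + 2 * a) * q0) <= y * ((m + 1 + a') * r1)).
  { split; [repeat apply Rmult_le_pos; lra|].
    apply Rmult_le_compat_l; [lra|]; apply Rle_trans with (2 := Hr).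
    apply Rmult_le_compat; lra. }
  split; apply Rmult_le_reg_l with (m + 1 + 1); lra.
Qed.

(** With [1 + x = 0] the middle term of the recurrence disappears and the two parities decouple. *)
Lemma mixed_coeff_m1_odd (a : R) (m : nat) : mixed_coeff a (-1) (S (2 * m)) = 0.
Proof.
induction m as [|m IH].
- simpl; rewrite mixed_coeff_1; ring.
- replace (S (2 * S m)) with (S (S (S (2 * m)))) by lia.
  assert (H := mixed_coeff_rec a (-1) (S (2 * m))); rewrite IH in H.
  apply Rmult_eq_reg_l with (INR (S (S (S (2 * m))))); [rewrite H; ring|].
  apply not_0_INR; lia.
Qed.

Lemma mixed_coeff_m1_even (a : R) (m : nat) : mixed_coeff a (-1) (2 * m) = binom_coeff a m.
Proof.
induction m as [|m IH].
- simpl; now rewrite mixed_coeff_0, binom_coeff_0.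
- replace (2 * S m)%nat with (S (S (2 * m))) by lia.
  assert (H := mixed_coeff_rec a (-1) (2 * m)); rewrite IH in H.
  assert (B := binom_coeff_S a m).
  apply Rmult_eq_reg_l with (INR (S (S (2 * m)))); [|apply not_0_INR; lia].
  rewrite H; replace (INR (S (S (2 * m)))) with (2 * INR (S m)).
  2:{ rewrite !S_INR, mult_INR; simpl; ring. }
  rewrite (Rmult_assoc 2 (INR (S m))), B, mult_INR; simpl (INR 2); ring.
Qed.

Section ClausenSum.

Variables a b c : R.
Hypotheses (ha : 0 < a) (hb : 0 < b) (hc : a + b < c).

(** These are the moments of the Beta law with parameters [b] and [c - b]. *)
Let moment (n : nat) : R := R_poch b n / R_poch c n.

Lemma moment_pos (n : nat) : 0 < moment n.
Proof. apply Rdiv_lt_0_compat; apply R_poch_pos; lra. Qed.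

(** This is the functional applied to [t^k (1 - t)^(- a)], a Gauss series with [b + k] and [c + k].
    The shift leaves [c - a - b] and [c - b] unchanged, so [k] enters only through two Pochhammer
    symbols. *)
Lemma is_series_row (k : nat) :
  is_series (fun j => binom_coeff a j * moment (k + j))
    (gauss_value a b c * (R_poch b k / R_poch (c - a) k)).
Proof.
assert (Hk := pos_INR k).
assert (P0 := R_poch_pos c k ltac:(lra)).
assert (P1 := R_poch_pos (c - a) k ltac:(lra)).
assert (G1 := Gamma_pos (c - a) ltac:(lra)).
assert (G2 := Gamma_pos (c - b) ltac:(lra)).
apply is_series_ext with (fun j => moment k * gauss_term a (b + INR k) (c + INR k) j).
- intros j; unfold moment, binom_coeff, gauss_term; rewrite !R_poch_add.
  assert (H2 := R_poch_pos (c + INR k) j ltac:(lra)).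
  assert (H3 := R_poch_pos 1 j Rlt_0_1).
  real_eq; field; repeat split; lra.
- replace (gauss_value a b c * (R_poch b k / R_poch (c - a) k))
    with (moment k * gauss_sum a (b + INR k) (c + INR k)).
  + apply (@is_series_scal_l _ R_NormedModule), Series_correct, ex_series_gauss; lra.
  + rewrite gauss_summation by lra; unfold gauss_value, moment.
    replace (c + INR k - a - (b + INR k)) with (c - a - b) by ring.
    replace (c + INR k - (b + INR k)) with (c - b) by ring.
    replace (c + INR k - a) with (c - a + INR k) by ring.
    rewrite !Gamma_add_nat by lra; field; repeat split; lra.
Qed.

(** Partial sums on the left are sums over triangles [k + j <= N]; grouping them by [k] lets
    dominated convergence do the work of Fubini. *)
Lemma mixed_series (x : R) :
  ex_series (fun k => gauss_term a b (c - a) k * Rabs x ^ k) ->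
  is_lim_seq (sum_n (fun n => mixed_coeff a x n * moment n))
    (gauss_value a b c * Series (fun k => gauss_term a b (c - a) k * x ^ k)).
Proof.
intros Hx.
set (row := fun k => gauss_value a b c * (R_poch b k / R_poch (c - a) k)).
assert (Hrow : forall k, binom_coeff a k * row k = gauss_value a b c * gauss_term a b (c - a) k).
{ intros k; unfold row, binom_coeff, gauss_term.
  assert (P1 := R_poch_pos (c - a) k ltac:(lra)).
  assert (H3 := R_poch_pos 1 k Rlt_0_1).
  field; lra. }
(* [f N k] is row [k] of the triangle; the full row of nonnegative terms bounds it uniformly in
   [N]. *)
set (f := fun N k => if (k <=? N)%nat
   then binom_coeff a k * x ^ k * sum_n (fun j => binom_coeff a j * moment (k + j)) (N - k) else 0).
apply is_lim_seq_ext with (fun N => Series (f N)).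
- intros N; rewrite (Series_finite (f N) N).
  2:{ intros k Hk; unfold f; destruct (Nat.leb_spec k N); [lia | reflexivity]. }
  symmetry; rewrite <- (sum_n_ext (fun n => sum_n (fun k => binom_coeff a k * x ^ k *
     (binom_coeff a (n - k) * moment (k + (n - k)))) n)).
  + rewrite (sum_n_triangle (fun k j => binom_coeff a k * x ^ k * (binom_coeff a j * moment (k + j)))).
    apply sum_n_ext_loc; intros k Hk; unfold f.
    destruct (Nat.leb_spec k N); [|lia]; apply (sum_n_scal_R (binom_coeff a k * x ^ k)).
  + intros n; unfold mixed_coeff; rewrite Rmult_comm, <- sum_n_scal_R.
    apply sum_n_ext_loc; intros k Hk; replace (k + (n - k))%nat with n by lia; real_eq; ring.
- rewrite <- Series_scal_l.
  apply Series_lim_dominated with (fun k => gauss_value a b c * (gauss_term a b (c - a) k * Rabs x ^ k)).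
  + intros N k; unfold f; assert (A := binom_coeff_pos a k ha).
    assert (G := gauss_value_ge_1 a b ha hb c hc).
    assert (G1 := gauss_term_pos a b (c - a) k ha hb ltac:(lra)).
    assert (Hxk : 0 <= Rabs x ^ k) by (apply pow_le, Rabs_pos).
    destruct (k <=? N)%nat.
    2:{ rewrite Rabs_R0; apply Rmult_le_pos; [lra | apply Rmult_le_pos; lra]. }
    rewrite <- Rmult_assoc, <- Hrow, !Rabs_mult, <- RPow_abs, (Rabs_pos_eq (binom_coeff a k)) by lra.
    rewrite Rmult_assoc, (Rmult_assoc _ (row k)), (Rmult_comm (row k)).
    apply Rmult_le_compat_l; [lra|]; apply Rmult_le_compat_l; [exact Hxk|].
    assert (Hpos : forall j, 0 <= binom_coeff a j * moment (k + j)).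
    { intros j; apply Rmult_le_pos; apply Rlt_le; [now apply binom_coeff_pos | apply moment_pos]. }
    rewrite Rabs_pos_eq.
    * unfold row; rewrite <- (is_series_unique _ _ (is_series_row k)).
      apply sum_n_le_Series; [exact Hpos | eexists; apply is_series_row].
    * now apply sum_n_nonneg.
  + now apply (@ex_series_scal_l _ R_NormedModule).
  + intros k; apply is_lim_seq_incr_n with k.
    apply is_lim_seq_ext with (fun N => binom_coeff a k * x ^ k *
      sum_n (fun j => binom_coeff a j * moment (k + j)) N).
    * intros N; unfold f; destruct (Nat.leb_spec k (N + k)); [|lia].
      now rewrite Nat.add_sub.
    * replace (gauss_value a b c * (gauss_term a b (c - a) k * x ^ k))
        with (binom_coeff a k * x ^ k * row k).
      -- apply is_lim_seq_mult'; [apply is_lim_seq_const | apply is_series_row].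
      -- rewrite <- Rmult_assoc, <- Hrow; ring.
Qed.

(** [G] is a limit from inside the disc, not the sum of the series at [-1], which may diverge when
    [a] is large. *)
Lemma clausen_sum (G : R) : 1 + b < c ->
  (forall y, 0 <= y < 1 -> ex_series (fun k => gauss_term a b (c - a) k * y ^ k)) ->
  is_lim_seq (fun N => Series (fun k => gauss_term a b (c - a) k * (- (1 - / (INR N + 1))) ^ k)) G ->
  is_series (fun m => binom_coeff a m * (R_poch b (2 * m) / R_poch c (2 * m)))
    (gauss_value a b c * G).
Proof.
intros hc1 Hex HG.
set (y := fun N => 1 - / (INR N + 1)) in HG.
assert (Hy : forall N, 0 <= y N < 1).
{ intros N; unfold y; assert (H := pos_INR N).
  assert (0 < / (INR N + 1)) by (apply Rinv_0_lt_compat; lra).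
  assert (/ (INR N + 1) <= / 1) by (apply Rinv_le_contravar; lra).
  rewrite Rinv_1 in *; lra. }
assert (Hylim : is_lim_seq y 1).
{ replace (Finite 1) with (Finite (1 - 0)) by (f_equal; ring).
  apply is_lim_seq_minus'; [apply is_lim_seq_const|].
  apply is_lim_seq_ext with (fun N => 1 / (1 + INR N)); [|apply is_lim_seq_inv_shift].
  intros N; rewrite Rplus_comm; unfold Rdiv; ring. }
(* The majorant needs [1 <= a'] to dominate and [a' + b < c] to be summable; for [a < 1] the latter
   is the hypothesis [1 + b < c]. *)
set (a' := Rmax a 1).
assert (Ha' : a <= a' /\ 1 <= a') by (split; [apply Rmax_l | apply Rmax_r]).
assert (Ha'c : a' + b < c) by (unfold a'; apply Rmax_case; lra).
set (g := fun n => binom_coeff a' n * moment n).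
assert (Hg : ex_series g).
{ apply ex_series_ext with (gauss_term a' b c); [|apply ex_series_gauss; lra].
  intros n; unfold g, binom_coeff, moment, gauss_term.
  assert (H1 := R_poch_pos c n ltac:(lra)); assert (H2 := R_poch_pos 1 n Rlt_0_1); real_eq; field; lra. }
assert (Hdom : forall z n, 0 <= z <= 1 -> Rabs (mixed_coeff a (- z) n * moment n) <= g n).
{ intros z n Hz; assert (B := mixed_coeff_bounds a a' z n ltac:(lra) (proj2 Ha') Hz).
  assert (M := moment_pos n).
  rewrite Rabs_pos_eq by (apply Rmult_le_pos; lra).
  apply Rmult_le_compat_r; lra. }
assert (L : is_lim_seq (fun N => Series (fun n => mixed_coeff a (- y N) n * moment n))
              (Series (fun n => mixed_coeff a (-1) n * moment n))).
{ apply (Series_lim_dominated (fun N n => mixed_coeff a (- y N) n * moment n)) with g.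
  - intros N k; apply Hdom; specialize (Hy N); lra.
  - exact Hg.
  - intros k; apply is_lim_seq_mult'; [|apply is_lim_seq_const].
    unfold mixed_coeff.
    apply (is_lim_seq_finite_sum
      (fun N j => binom_coeff a j * (- y N) ^ j * binom_coeff a (k - j))).
    intros j; apply is_lim_seq_mult'; [|apply is_lim_seq_const].
    apply is_lim_seq_mult'; [apply is_lim_seq_const|].
    apply (is_lim_seq_continuous (fun z => z ^ j)).
    + apply derivable_continuous_pt, derivable_pt_pow.
    + exact (proj1 (is_lim_seq_opp y 1) Hylim). }
assert (L2 : is_lim_seq (fun N => Series (fun n => mixed_coeff a (- y N) n * moment n))
               (gauss_value a b c * G)).
{ apply is_lim_seq_ext with
    (2 := is_lim_seq_mult' _ _ _ _ (is_lim_seq_const (gauss_value a b c)) HG).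
  intros N; symmetry; apply is_series_unique, mixed_series.
  rewrite Rabs_Ropp, Rabs_pos_eq by apply Hy; apply Hex, Hy. }
apply is_lim_seq_unique in L; apply is_lim_seq_unique in L2; rewrite L in L2.
injection L2 as E.
assert (HS : is_series (fun n => mixed_coeff a (-1) n * moment n) (gauss_value a b c * G)).
{ rewrite <- E; apply Series_correct, ex_series_abs_le with g; [|exact Hg].
  intros n; replace (-1) with (- (1)) by ring; apply Hdom; lra. }
apply is_series_even in HS.
- apply is_series_ext with (2 := HS); intros m; now rewrite mixed_coeff_m1_even.
- intros m; rewrite mixed_coeff_m1_odd; ring.
Qed.

End ClausenSum.

(** * Complex power series *)

Local Notation C_series := (@is_series C_AbsRing C_NormedModule).
Local Notation C_pseries := (@is_pseries C_AbsRing C_NormedModule).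
Local Notation C_sum := (@sum_n C_AbelianGroup).

Lemma pow_n_Cpow (z : C) (n : nat) : @pow_n C_Ring z n = (z ^ n)%C.
Proof.
induction n as [|n IH]; [reflexivity|].
rewrite Cpow_S, <- IH; reflexivity.
Qed.

Lemma C_pseries_series (u : nat -> C) (z l : C) :
  C_pseries u z l <-> C_series (fun n => (u n * z ^ n)%C) l.
Proof.
assert (E : forall n, @scal C_AbsRing C_NormedModule (@pow_n C_Ring z n) (u n) = (u n * z ^ n)%C).
{ intros n; rewrite pow_n_Cpow; unfold scal; simpl; apply Cmult_comm. }
split; apply is_series_ext; [exact E | intros n; symmetry; apply E].
Qed.

Lemma C_series_unique (u : nat -> C) (l l' : C) : C_series u l -> C_series u l' -> l = l'.
Proof. exact (@filterlim_locally_unique nat C_AbsRing C_NormedModule eventually _ _ l l'). Qed.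

Lemma Re_sum_n (u : nat -> C) (n : nat) : Re (C_sum u n) = sum_n (fun k => Re (u k)) n.
Proof.
induction n as [|n IH]; [now rewrite !sum_O|].
rewrite sum_n_S, <- IH; exact (f_equal Re (sum_Sn (G := C_AbelianGroup) u n)).
Qed.

Lemma is_series_Re (u : nat -> C) (l : C) :
  C_series u l -> is_series (fun n => Re (u n)) (Re l).
Proof.
intros H; change (filterlim (sum_n (fun n => Re (u n))) eventually (locally (Re l))).
apply filterlim_ext with (fun n => Re (C_sum u n)); [intros; apply Re_sum_n|].
refine (filterlim_comp _ _ _ _ Re _ _ _ H _).
exact (@continuous_fst R_UniformSpace R_UniformSpace (fst l) (snd l)).
Qed.

Lemma Cmod_series_le (u : nat -> C) (v : nat -> R) (l : C) (s : R) :
  C_series u l -> (forall n, Cmod (u n) <= v n) -> is_series v s -> Cmod l <= s.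
Proof.
intros Hu Huv Hv.
assert (H : forall n, Cmod (C_sum u n) <= sum_n v n).
{ induction n as [|n IH]; [rewrite !sum_O; apply Huv|].
  rewrite sum_n_S, (sum_Sn (G := C_AbelianGroup)).
  apply Rle_trans with (1 := Cmod_triangle _ _).
  apply Rplus_le_compat; [exact IH | apply Huv]. }
assert (L : is_lim_seq (fun n => Cmod (C_sum u n)) (Cmod l)).
{ exact (filterlim_comp _ _ _ _ (@norm C_AbsRing C_NormedModule) _ _ _ Hu
    (@filterlim_norm C_AbsRing C_NormedModule l)). }
exact (is_lim_seq_le _ _ (Cmod l) s H L Hv).
Qed.

Lemma C_ex_series_le (u : nat -> C) (v : nat -> R) :
  (forall n, Cmod (u n) <= v n) -> ex_series v -> exists l, C_series u l.
Proof. exact (@ex_series_le C_AbsRing C_CompleteNormedModule u v). Qed.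

Lemma C_series_bounded (u : nat -> C) (l : C) :
  C_series u l -> exists M, forall n, Cmod (u n) <= M.
Proof.
intros H.
destruct (@filterlim_bounded C_AbsRing C_NormedModule (C_sum u) (ex_intro _ l H)) as [M HM].
exists (M + M); intros [|n].
- specialize (HM 0%nat); rewrite sum_O in HM.
  assert (H0 := Cmod_ge_0 (u 0%nat)); change (Cmod (u 0%nat) <= M) in HM; lra.
- assert (H1 := HM (S n)); assert (H0 := HM n).
  change (Cmod (C_sum u n) <= M) in H0; change (Cmod (C_sum u (S n)) <= M) in H1.
  assert (E := sum_Sn (G := C_AbelianGroup) u n); unfold plus in E; simpl in E.
  replace (u (S n)) with (C_sum u (S n) + - C_sum u n)%C by (rewrite E; ring).
  apply Rle_trans with (1 := Cmod_triangle _ _); rewrite Cmod_opp; lra.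
Qed.

Lemma C_series_scal (a : C) (u : nat -> C) (l : C) :
  C_series u l -> C_series (fun n => (a * u n)%C) (a * l)%C.
Proof. exact (@is_series_scal C_AbsRing C_NormedModule a u l). Qed.

Lemma C_series_minus (u v : nat -> C) (l m : C) :
  C_series u l -> C_series v m -> C_series (fun n => (u n - v n)%C) (l - m)%C.
Proof. exact (@is_series_minus C_AbsRing C_NormedModule u v l m). Qed.

Lemma C_series_ext (u v : nat -> C) (l : C) :
  (forall n, u n = v n) -> C_series u l -> C_series v l.
Proof. exact (@is_series_ext C_AbsRing C_NormedModule u v l). Qed.

Lemma C_series_decr_1 (u : nat -> C) (l : C) :
  C_series (fun n => u (S n)) l -> C_series u (l + u 0%nat)%C.
Proof.
intros H; apply is_series_decr_1.
replace (plus _ _) with l; [exact H|].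
change (l = (l + u 0%nat) + - u 0%nat)%C; ring.
Qed.

Lemma C_series_incr_1 (u : nat -> C) (l : C) :
  C_series u l -> C_series (fun n => u (S n)) (l - u 0%nat)%C.
Proof.
intros H; apply is_series_incr_1.
replace (plus _ _) with l; [exact H|].
change (l = (l - u 0%nat) + u 0%nat)%C; ring.
Qed.

Lemma C_series_tail (u : nat -> C) (l : C) (M : nat) :
  C_series u l -> C_series (fun n => u (S M + n)%nat) (l - C_sum u M)%C.
Proof.
intros H; apply is_series_incr_n; [lia|]; simpl pred.
replace (plus _ _) with l; [exact H|].
change (l = (l - C_sum u M) + C_sum u M)%C; ring.
Qed.

Lemma C_series_const0 (a : C) : C_series (fun n => match n with O => a | S _ => RtoC 0 end) a.
Proof.
enough (H : C_series (fun _ => RtoC 0) (RtoC 0)).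
{ apply (C_series_decr_1 (fun n => match n with O => a | S _ => RtoC 0 end)) in H.
  now rewrite Cplus_0_l in H. }
apply filterlim_ext with (fun _ : nat => RtoC 0); [|apply filterlim_const].
induction x as [|n IH]; [now rewrite sum_O|].
rewrite sum_Sn, <- IH; change (RtoC 0 = RtoC 0 + RtoC 0)%C; ring.
Qed.

(** At [r = 1] this unfolds to [expands_on_disc]; other radii serve the local expansions of
    [analytic_at]. *)
Definition expands_on (r : R) (f : C -> C) (u : nat -> C) : Prop :=
  forall z : C, Cmod z < r -> C_pseries u z (f z).

(** Passing to the moduli makes the real theory of the radius of convergence available, notably its
    invariance under differentiation. Boundedness of the terms at one real point between [rho] and
    [r] suffices. *)
Lemma CV_radius_expands (r rho : R) (f : C -> C) (u : nat -> C) :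
  expands_on r f u -> 0 <= rho < r -> Rbar_lt rho (CV_radius (fun n => Cmod (u n))).
Proof.
intros Hf Hrho; set (r' := (rho + r) / 2).
apply Rbar_lt_le_trans with r'; [unfold r'; simpl; lra|].
apply (proj1 (CV_radius_bounded (fun n => Cmod (u n)))).
assert (Hr' : Cmod (RtoC r') < r) by (rewrite Cmod_R, Rabs_pos_eq; unfold r'; lra).
destruct (C_series_bounded _ _ (proj1 (C_pseries_series _ _ _) (Hf _ Hr'))) as [M HM].
exists M; intros n; specialize (HM n).
rewrite Cmod_mult, Cmod_pow, Cmod_R in HM.
rewrite Rabs_mult, <- RPow_abs, (Rabs_pos_eq (Cmod _)) by apply Cmod_ge_0; exact HM.
Qed.

Lemma expands_on_ex_abs (r rho : R) (f : C -> C) (u : nat -> C) :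
  expands_on r f u -> 0 <= rho < r -> ex_series (fun n => Cmod (u n) * rho ^ n).
Proof.
intros Hf Hrho; apply ex_pseries_R, CV_radius_inside.
rewrite Rabs_pos_eq by lra; exact (CV_radius_expands r rho f u Hf Hrho).
Qed.

Definition C_PS_derive (u : nat -> C) (n : nat) : C := (RtoC (INR (S n)) * u (S n))%C.

Lemma Cmod_INR (n : nat) : Cmod (RtoC (INR n)) = INR n.
Proof. rewrite Cmod_R; apply Rabs_pos_eq, pos_INR. Qed.

(** The constant is the second derivative of [t^(m+2)] at [rho], so that these bounds sum to a twice
    differentiated power series. In the induction the new remainder is [w] times the old one plus a
    multiple of [(w - z)^2]. *)
Lemma Cpow_taylor_bound (w z : C) (rho : R) (m : nat) : Cmod w <= rho -> Cmod z <= rho ->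
  Cmod (w ^ S (S m) - z ^ S (S m) - RtoC (INR (S (S m))) * z ^ S m * (w - z))
  <= INR (S (S m)) * INR (S m) * rho ^ m * Cmod (w - z) ^ 2.
Proof.
intros Hw Hz; induction m as [|m IH].
- replace (w ^ 2 - z ^ 2 - RtoC (INR 2) * z ^ 1 * (w - z))%C with ((w - z) * (w - z))%C.
  2:{ replace (RtoC (INR 2)) with (1 + 1)%C by (simpl; now rewrite RtoC_plus). simpl; ring. }
  rewrite Cmod_mult; simpl; assert (H := Cmod_ge_0 (w - z)); nra.
- set (k := S (S m)) in *.
  replace (w ^ S k - z ^ S k - RtoC (INR (S k)) * z ^ k * (w - z))%C with
    (w * (w ^ k - z ^ k - RtoC (INR k) * z ^ S m * (w - z))
     + RtoC (INR k) * z ^ S m * ((w - z) * (w - z)))%C.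
  2:{ rewrite (S_INR k), RtoC_plus; unfold k; simpl Cpow; ring. }
  apply Rle_trans with (1 := Cmod_triangle _ _).
  rewrite !Cmod_mult, Cmod_INR, Cmod_pow.
  assert (Hzm : Cmod z ^ S m <= rho ^ S m) by (apply pow_incr; split; [apply Cmod_ge_0 | exact Hz]).
  assert (Hrho : 0 <= rho) by (assert (H := Cmod_ge_0 w); lra).
  assert (Hd := Cmod_ge_0 (w - z)); set (d := Cmod (w - z)) in *.
  assert (Hk := pos_INR k); assert (Hp : 0 <= rho ^ S m) by now apply pow_le.
  apply Rle_trans with (rho * (INR k * INR (S m) * rho ^ m * d ^ 2) + INR k * rho ^ S m * (d * d)).
  + apply Rplus_le_compat.
    * apply Rmult_le_compat; [apply Cmod_ge_0 | apply Cmod_ge_0 | exact Hw | exact IH].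
    * apply Rmult_le_compat_r; [nra|]; now apply Rmult_le_compat_l.
  + replace (rho * (INR k * INR (S m) * rho ^ m * d ^ 2) + INR k * rho ^ S m * (d * d))
      with (INR k * rho ^ S m * d ^ 2 * (INR (S m) + 1)) by (simpl; ring).
    replace (INR (S k) * INR k * rho ^ S m * d ^ 2)
      with (INR k * rho ^ S m * d ^ 2 * INR (S k)) by ring.
    apply Rmult_le_compat_l.
    * apply Rmult_le_pos; [now apply Rmult_le_pos | apply pow_le; exact Hd].
    * unfold k; rewrite !S_INR; lra.
Qed.

(** Summing the second-order remainders of the powers gives an error [O(|w - z|^2)], which justifies
    differentiation term by term. *)
Lemma expands_on_derive (r : R) (f : C -> C) (u : nat -> C) (z : C) :
  expands_on r f u -> Cmod z < r ->
  exists l, C_pseries (C_PS_derive u) z l /\ @is_derive C_AbsRing C_NormedModule f z l.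
Proof.
intros Hf Hz.
assert (Hz0 := Cmod_ge_0 z).
set (a := fun n => Cmod (u n)).
assert (Hl : exists l, C_series (fun n => (C_PS_derive u n * z ^ n)%C) l).
{ apply C_ex_series_le with (fun n => PS_derive a n * Cmod z ^ n).
  - intros n; unfold C_PS_derive, PS_derive, a.
    rewrite !Cmod_mult, Cmod_INR, Cmod_pow; lra.
  - apply ex_pseries_R, CV_radius_inside; rewrite CV_radius_derive, Rabs_pos_eq by lra.
    apply (CV_radius_expands r _ f); [exact Hf | lra]. }
destruct Hl as [l Hl]; exists l; split; [now apply C_pseries_series|].
set (rho := (Cmod z + r) / 2).
assert (Hrho : Cmod z < rho < r) by (unfold rho; lra).
set (v := fun m => INR (S (S m)) * INR (S m) * a (S (S m)) * rho ^ m).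
assert (Hv : ex_series v).
{ apply ex_series_ext with (fun m => PS_derive (PS_derive a) m * rho ^ m).
  - intros m; unfold v, PS_derive; real_eq; ring.
  - apply ex_pseries_R, CV_radius_inside; rewrite !CV_radius_derive, Rabs_pos_eq by lra.
    apply (CV_radius_expands r _ f); [exact Hf | lra]. }
assert (Hl' : C_series (fun n => u n * (RtoC (INR n) * z ^ pred n))%C l).
{ replace l with (l + (u 0%nat * (RtoC (INR 0) * z ^ pred 0)))%C by (simpl; ring).
  apply (C_series_decr_1 (fun n => u n * (RtoC (INR n) * z ^ pred n))%C).
  apply C_series_ext with (2 := Hl); intros n; unfold C_PS_derive; simpl pred; ring. }
assert (Hmain : forall w, Cmod w <= rho ->
  Cmod (f w - f z - (w - z) * l) <= Series v * Cmod (w - z) ^ 2).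
{ intros w Hw.
  assert (Sw := proj1 (C_pseries_series _ _ _) (Hf w ltac:(lra))).
  assert (Sz := proj1 (C_pseries_series _ _ _) (Hf z Hz)).
  assert (H := C_series_minus _ _ _ _ (C_series_minus _ _ _ _ Sw Sz) (C_series_scal (w - z) _ _ Hl')).
  (* The remainders of degree 0 and 1 vanish, so dropping them leaves the sum unchanged. *)
  apply C_series_incr_1, C_series_incr_1 in H.
  apply (Cmod_series_le _ (fun m => v m * Cmod (w - z) ^ 2)) with (s := Series v * Cmod (w - z) ^ 2) in H.
  - revert H; match goal with |- Cmod ?x <= _ -> Cmod ?y <= _ => replace x with y; [easy|] end.
    simpl; ring.
  - intros m.
    replace (_ - _)%C with (u (S (S m)) *
      (w ^ S (S m) - z ^ S (S m) - RtoC (INR (S (S m))) * z ^ S m * (w - z)))%C.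
    2:{ simpl pred; ring. }
    rewrite Cmod_mult; unfold v; fold (a (S (S m))).
    assert (B := Cpow_taylor_bound w z rho m Hw ltac:(lra)).
    apply Rmult_le_compat_l with (r := a (S (S m))) in B; [|apply Cmod_ge_0].
    lra.
  - apply is_series_scal_r, Series_correct, Hv. }
split; [apply is_linear_scal_l|].
intros x Hx eps.
rewrite <- (is_filter_lim_locally_unique _ _ Hx).
assert (HV : 0 <= Series v).
{ rewrite <- (Rmult_0_l (Series v)), <- Series_scal_l; apply Series_le; [|exact Hv].
  intros m; rewrite Rmult_0_l; split; [lra|]; unfold v, a.
  repeat apply Rmult_le_pos; [apply pos_INR | apply pos_INR | apply Cmod_ge_0 | apply pow_le; lra]. }
(* The first bound keeps [w] in the disc of radius [rho], the second makes the quadratic error at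
   most [eps |w - z|]; adding 1 avoids a zero denominator. *)
assert (Hd : 0 < Rmin (rho - Cmod z) (eps / (Series v + 1))).
{ apply Rmin_pos; [lra|]; apply Rdiv_lt_0_compat; [apply cond_pos | lra]. }
exists (mkposreal _ Hd); intros w Hw.
change (Cmod (w - z) < Rmin (rho - Cmod z) (eps / (Series v + 1))) in Hw.
assert (Hw1 := Rlt_le_trans _ _ _ Hw (Rmin_l _ _)).
assert (Hw2 := Rlt_le_trans _ _ _ Hw (Rmin_r _ _)).
change (Cmod (f w - f z - (w - z) * l) <= eps * Cmod (w - z)).
assert (Hwr : Cmod w <= rho).
{ replace w with ((w - z) + z)%C by ring; apply Rle_trans with (1 := Cmod_triangle _ _); lra. }
apply Rle_trans with (1 := Hmain w Hwr).
assert (Hd0 := Cmod_ge_0 (w - z)); set (d := Cmod (w - z)) in *.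
replace (Series v * d ^ 2) with ((Series v * d) * d) by ring.
apply Rmult_le_compat_r; [exact Hd0|].
apply Rmult_lt_compat_r with (r := Series v + 1) in Hw2; [|lra].
replace (eps / (Series v + 1) * (Series v + 1)) with (pos eps) in Hw2 by (field; lra).
lra.
Qed.

Lemma expands_on_C_derive (r : R) (f : C -> C) (u : nat -> C) :
  expands_on r f u -> expands_on r (C_derive f) (C_PS_derive u).
Proof.
intros Hf z Hz; destruct (expands_on_derive r f u z Hf Hz) as (l & Hl & Hd).
now rewrite (is_C_derive_unique f z l Hd).
Qed.

Lemma expands_on_z_derive (r : R) (f : C -> C) (u : nat -> C) :
  expands_on r f u ->
  expands_on r (fun z => z * C_derive f z)%C (fun n => RtoC (INR n) * u n)%C.
Proof.
intros Hf z Hz; assert (Hd := expands_on_C_derive r f u Hf z Hz).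
apply C_pseries_series, (C_series_scal z) in Hd; apply C_pseries_series.
replace (z * C_derive f z)%C with (z * C_derive f z + RtoC (INR 0) * u 0%nat * z ^ 0)%C
  by (simpl; ring).
apply (C_series_decr_1 (fun n => RtoC (INR n) * u n * z ^ n)%C).
apply C_series_ext with (2 := Hd); intros n; unfold C_PS_derive; rewrite Cpow_S; ring.
Qed.

(** By induction the [n]-th derivative has coefficients [(n + k)! / k!] times [u (n + k)]; evaluate
    at 0. *)
Lemma taylor_coeff_expands (f : C -> C) (u : nat -> C) (n : nat) :
  expands_on_disc f u -> taylor_coeff f n = u n.
Proof.
intros Hf.
assert (H : expands_on 1 (C_derive_n f n)
   (fun k => (RtoC (INR (Factorial.fact (n + k)) / INR (Factorial.fact k)) * u (n + k)%nat)%C)).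
{ induction n as [|n IH].
  - intros z Hz; specialize (Hf z Hz); apply C_pseries_series in Hf; apply C_pseries_series.
    apply C_series_ext with (2 := Hf); intros k; simpl.
    unfold Rdiv; rewrite Rinv_r by apply INR_fact_neq_0; ring.
  - apply expands_on_C_derive in IH; intros z Hz; specialize (IH z Hz).
    apply C_pseries_series in IH; apply C_pseries_series.
    apply C_series_ext with (2 := IH); intros k; unfold C_PS_derive; f_equal.
    rewrite Cmult_assoc, <- RtoC_mult, Nat.add_succ_r; simpl (S n + k)%nat; f_equal; f_equal.
    change (Factorial.fact (S k)) with (S k * Factorial.fact k)%nat; rewrite mult_INR.
    field; split; [apply INR_fact_neq_0 | apply not_0_INR; lia]. }
assert (H0 := H (RtoC 0) ltac:(rewrite Cmod_0; lra)).
unfold taylor_coeff.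
assert (H1 := @is_pseries_0 C_AbsRing C_NormedModule
   (fun k => (RtoC (INR (Factorial.fact (n + k)) / INR (Factorial.fact k)) * u (n + k)%nat)%C)).
rewrite (C_series_unique _ _ _ H0 H1), Nat.add_0_r; simpl (INR (Factorial.fact 0)).
rewrite RtoC_div by lra.
assert (RtoC (INR (Factorial.fact n)) <> RtoC 0).
{ intros E; apply RtoC_inj in E; now apply INR_fact_neq_0 in E. }
field; assumption.
Qed.

(** * Coefficient conditions *)

Lemma C_poch_RtoC (x : R) (n : nat) : C_poch (RtoC x) n = RtoC (R_poch x n).
Proof.
induction n as [|n IH]; [reflexivity|].
simpl; now rewrite IH, RtoC_mult, RtoC_plus.
Qed.

Lemma coeff_2F1_RtoC (a b d : R) (n : nat) : 0 < d ->
  coeff_2F1 (RtoC a) (RtoC b) (RtoC d) n = RtoC (gauss_term a b d n).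
Proof.
intros Hd; unfold coeff_2F1, gauss_term.
assert (H1 := R_poch_pos d n Hd); assert (H2 := R_poch_pos 1 n Rlt_0_1).
rewrite !C_poch_RtoC, RtoC_div, !RtoC_mult; [reflexivity|].
apply Rgt_not_eq, Rmult_lt_0_compat; assumption.
Qed.

Lemma is_2F1_series (a b d : R) (F : C -> C) (x : R) : 0 < d -> Rabs x < 1 ->
  is_2F1 (RtoC a) (RtoC b) (RtoC d) F ->
  is_series (fun k => gauss_term a b d k * x ^ k) (Re (F (RtoC x))).
Proof.
intros Hd Hx [HF _].
assert (H := HF (RtoC x) ltac:(unfold in_disc; now rewrite Cmod_R)).
apply C_pseries_series, is_series_Re in H.
apply is_series_ext with (2 := H); intros n.
now rewrite coeff_2F1_RtoC, <- RtoC_pow, <- RtoC_mult by exact Hd.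
Qed.

(** Recentring at 0 lets [expands_on_derive] give differentiability, hence continuity, at the
    point. *)
Lemma analytic_at_lim (F : C -> C) (x : R) (h : nat -> R) :
  analytic_at F (RtoC x) -> is_lim_seq h 0 ->
  is_lim_seq (fun N => Re (F (RtoC (x + h N)))) (Re (F (RtoC x))).
Proof.
intros (u & r & Hr & HF) Hh.
set (G := fun w => F (RtoC x + w)%C).
assert (HG : expands_on r G u).
{ intros w Hw; unfold G.
  replace w with (RtoC x + w - RtoC x)%C at 1 by ring.
  apply HF; replace (RtoC x + w - RtoC x)%C with w by ring; exact Hw. }
destruct (expands_on_derive r G u (RtoC 0) HG) as (l & _ & Hl); [now rewrite Cmod_0|].
assert (Hc := @ex_derive_continuous C_AbsRing C_NormedModule G (RtoC 0) (ex_intro _ l Hl)).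
assert (Hh' : filterlim (fun N => RtoC (h N)) eventually
   (@locally (AbsRing_UniformSpace C_AbsRing) (RtoC 0))).
{ intros P [eps HP]; destruct (proj2 (is_lim_seq_spec _ (Finite _)) Hh eps) as [N0 HN0].
  exists N0; intros N HN; specialize (HN0 N HN); apply HP.
  change (Cmod (RtoC (h N) - RtoC 0) < eps).
  now rewrite <- RtoC_minus, Cmod_R. }
assert (HR := @continuous_fst R_UniformSpace R_UniformSpace (fst (G (RtoC 0))) (snd (G (RtoC 0)))).
assert (L := filterlim_comp _ _ _ _ _ _ _ _ (filterlim_comp _ _ _ _ _ _ _ _ Hh' Hc) HR).
replace (Re (F (RtoC x))) with (fst (G (RtoC 0))).
2:{ unfold G; now rewrite Cplus_0_r. }
apply is_lim_seq_ext with (2 := L).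
intros N; unfold G; now rewrite <- RtoC_plus.
Qed.

(** The coefficient bound gives [|z h' - h| + lam |h - z| < lam |z|]. Combined with
    [|z| <= |h| + |h - z|], this yields both [h <> 0] and [|z h' - h| < lam |h|]. *)
Lemma class_S_of_coeffs (lam l : R) (h : C -> C) (u : nat -> C) :
  0 < lam -> u 0%nat = RtoC 0 -> u 1%nat = RtoC 1 -> expands_on_disc h u ->
  is_series (fun m => (INR (S m) + lam) * Cmod (u (S (S m)))) l -> l <= lam ->
  class_S lam h.
Proof.
intros Hlam Hu0 Hu1 Hh Hl Hle; split; [now exists u|].
intros z Hz Hz0.
assert (Hr : 0 < Cmod z) by now apply Cmod_gt_0.
set (r := Cmod z) in *.
assert (Hzd := expands_on_z_derive 1 h u Hh z Hz).
assert (Hhz := Hh z Hz).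
apply C_pseries_series in Hzd, Hhz.
set (d := C_derive h z) in *.
assert (HA := C_series_incr_1 _ _ (C_series_incr_1 _ _ (C_series_minus _ _ _ _ Hzd Hhz))).
assert (HB := C_series_incr_1 _ _ (C_series_incr_1 _ _ Hhz)).
cbv beta in HA, HB.
match type of HA with C_series _ ?x => replace x with (z * d - h z)%C in HA end.
2:{ rewrite Hu0, Hu1; simpl; ring. }
match type of HB with C_series _ ?x => replace x with (h z - z)%C in HB end.
2:{ rewrite Hu0, Hu1; simpl; ring. }
set (a := fun m => Cmod (u (S (S m)))) in *.
assert (Ha : forall m, 0 <= a m) by (intros; apply Cmod_ge_0).
assert (E1 : ex_series (fun m => INR (S m) * a m)).
{ apply ex_series_abs_le with (2 := ex_intro _ l Hl); intros m; specialize (Ha m).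
  assert (H := pos_INR (S m)).
  rewrite Rabs_pos_eq by now apply Rmult_le_pos.
  apply Rmult_le_compat_r; [exact Ha | lra]. }
assert (E2 : ex_series a).
{ apply ex_series_abs_le with (2 := E1); intros m; specialize (Ha m).
  rewrite Rabs_pos_eq by exact Ha; rewrite S_INR; assert (H := pos_INR m); nra. }
assert (El : l = Series (fun m => INR (S m) * a m) + lam * Series a).
{ rewrite <- (is_series_unique _ _ Hl), <- Series_scal_l, <- Series_plus; [| exact E1 |].
  - apply Series_ext; intros m; unfold a; ring.
  - now apply (@ex_series_scal_l _ R_NormedModule). }
set (s1 := Series (fun m => INR (S m) * a m)) in *; set (s2 := Series a) in *.
assert (Hpow : forall m, r ^ S (S m) <= r ^ 2).
{ intros m; simpl; rewrite <- !(Rmult_assoc r r).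
  apply Rmult_le_compat_l; [nra|].
  rewrite <- (pow1 m); apply pow_incr; unfold in_disc in Hz; fold r in Hz; lra. }
assert (A : Cmod (z * d - h z) <= s1 * r ^ 2).
{ apply (Cmod_series_le _ (fun m => INR (S m) * a m * r ^ 2) _ _ HA).
  - intros m.
    replace (RtoC (INR (S (S m))) * u (S (S m)) * z ^ S (S m) - u (S (S m)) * z ^ S (S m))%C
      with (RtoC (INR (S m)) * u (S (S m)) * z ^ S (S m))%C.
    2:{ rewrite (S_INR (S m)), RtoC_plus; ring. }
    rewrite !Cmod_mult, Cmod_INR, Cmod_pow; fold (a m) r.
    apply Rmult_le_compat_l; [|apply Hpow].
    apply Rmult_le_pos; [apply pos_INR | apply Ha].
  - apply is_series_scal_r, Series_correct, E1. }
assert (B : Cmod (h z - z) <= s2 * r ^ 2).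
{ apply (Cmod_series_le _ (fun m => a m * r ^ 2) _ _ HB).
  - intros m; rewrite !Cmod_mult, Cmod_pow; fold (a m) r.
    apply Rmult_le_compat_l; [apply Ha | apply Hpow].
  - apply is_series_scal_r, Series_correct, E2. }
(* Both expansions start at degree 2, which gives [r^2]; strictness comes from [r^2 < r]. *)
assert (HAB : Cmod (z * d - h z) + lam * Cmod (h z - z) < lam * r).
{ apply Rle_lt_trans with (l * r ^ 2).
  - rewrite El; apply Rmult_le_compat_l with (r := lam) in B; lra.
  - unfold in_disc in Hz; fold r in Hz.
    apply Rle_lt_trans with (lam * r ^ 2); [apply Rmult_le_compat_r; nra|].
    apply Rmult_lt_compat_l; [exact Hlam | nra]. }
assert (Hrz : r <= Cmod (h z) + Cmod (h z - z)).
{ unfold r; replace z with (h z + - (h z - z))%C at 1 by ring.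
  apply Rle_trans with (1 := Cmod_triangle _ _); rewrite Cmod_opp; lra. }
assert (HA0 := Cmod_ge_0 (z * d - h z)).
assert (Hpos : 0 < Cmod (h z)).
{ apply Rnot_le_lt; intros Hn; nra. }
assert (Hne : h z <> RtoC 0) by now apply Cmod_gt_0.
split; [exact Hne|].
replace (z * d / h z - 1)%C with ((z * d - h z) / h z)%C by (field; exact Hne).
rewrite Cmod_div by exact Hne.
apply Rmult_lt_reg_r with (Cmod (h z)); [exact Hpos|].
unfold Rdiv; rewrite Rmult_assoc, Rinv_l by lra; rewrite Rmult_1_r.
nra.
Qed.

(** * Roots of unity and Caratheodory's inequality *)

Definition cis (t : R) : C := (cos t, sin t).

Lemma cis_plus (s t : R) : cis (s + t) = (cis s * cis t)%C.
Proof. unfold cis, Cmult; simpl; now rewrite cos_plus, sin_plus, (Rplus_comm (sin s * _)). Qed.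

Lemma Cmod_cis (t : R) : Cmod (cis t) = 1.
Proof.
unfold Cmod, cis; simpl; rewrite !Rmult_1_r.
assert (H := sin2_cos2 t); unfold Rsqr in H.
rewrite Rplus_comm, H; apply sqrt_1.
Qed.

Lemma cis_pow (t : R) (n : nat) : (cis t ^ n)%C = cis (INR n * t).
Proof.
induction n as [|n IH].
- simpl; rewrite Rmult_0_l; unfold cis; now rewrite cos_0, sin_0.
- rewrite Cpow_S, IH, <- cis_plus, S_INR; f_equal; ring.
Qed.

Lemma cis_2PI_frac_neq_1 (t : R) : 0 < t < 1 -> cis (2 * PI * t) <> RtoC 1.
Proof.
intros Ht E; apply (f_equal Re) in E; simpl in E.
replace (2 * PI * t) with (2 * (PI * t)) in E by ring; rewrite cos_2a_sin in E.
assert (H := PI_RGT_0).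
assert (0 < sin (PI * t)) by (apply sin_gt_0; nra).
nra.
Qed.

Definition unity_root (N : nat) : C := cis (2 * PI * / INR N).

Lemma unity_root_pow_N (N : nat) : (0 < N)%nat -> (unity_root N ^ N)%C = RtoC 1.
Proof.
intros HN; unfold unity_root; rewrite cis_pow.
replace (INR N * (2 * PI * / INR N)) with (2 * PI) by (field; apply not_0_INR; lia).
unfold cis; now rewrite cos_2PI, sin_2PI.
Qed.

Lemma unity_root_pow_neq_1 (N m : nat) : (0 < m < N)%nat -> (unity_root N ^ m)%C <> RtoC 1.
Proof.
intros Hm; unfold unity_root; rewrite cis_pow.
assert (H1 : 0 < INR m) by (apply lt_0_INR; lia).
assert (H2 : INR m < INR N) by (apply lt_INR; lia).
replace (INR m * (2 * PI * / INR N)) with (2 * PI * (INR m / INR N)) by (field; lra).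
apply cis_2PI_frac_neq_1; split; [apply Rdiv_lt_0_compat; lra|].
apply Rmult_lt_reg_r with (INR N); [lra|].
unfold Rdiv; rewrite Rmult_assoc, Rinv_l by lra; lra.
Qed.

Lemma C_sum_0 (u : nat -> C) : C_sum u 0 = u 0%nat :> C.
Proof. exact (sum_O (G := C_AbelianGroup) u). Qed.

Lemma C_sum_S (u : nat -> C) (n : nat) : C_sum u (S n) = (C_sum u n + u (S n))%C :> C.
Proof. exact (sum_Sn (G := C_AbelianGroup) u n). Qed.

Lemma C_sum_scal (a : C) (u : nat -> C) (n : nat) :
  C_sum (fun k => a * u k)%C n = (a * C_sum u n)%C :> C.
Proof. exact (sum_n_mult_l (K := C_Ring) a u n). Qed.

Lemma C_sum_plus (u v : nat -> C) (n : nat) :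
  C_sum (fun k => u k + v k)%C n = (C_sum u n + C_sum v n)%C :> C.
Proof. exact (sum_n_plus (G := C_AbelianGroup) u v n). Qed.

Lemma C_sum_ext (u v : nat -> C) (n : nat) :
  (forall k, (k <= n)%nat -> u k = v k) -> C_sum u n = C_sum v n :> C.
Proof. exact (sum_n_ext_loc (G := C_AbelianGroup) u v n). Qed.

Lemma C_sum_single (u : nat -> C) (j n : nat) : (j <= n)%nat ->
  (forall k, (k <= n)%nat -> k <> j -> u k = RtoC 0) -> C_sum u n = u j :> C.
Proof.
revert j; induction n as [|n IH]; intros j Hj Hu.
- replace j with 0%nat by lia; apply C_sum_0.
- rewrite C_sum_S; destruct (Nat.eq_dec j (S n)) as [-> | Hn].
  + rewrite (C_sum_ext _ (fun _ => RtoC 0 * RtoC 0)%C).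
    * rewrite C_sum_scal; ring.
    * intros k Hk; rewrite Hu by lia; ring.
  + rewrite (IH j), (Hu (S n)) by (lia || (intros; apply Hu; lia)); ring.
Qed.

Lemma C_sum_const (a : C) (n : nat) : C_sum (fun _ => a) n = (RtoC (INR (S n)) * a)%C :> C.
Proof.
induction n as [|n IH].
- rewrite C_sum_0; simpl; ring.
- rewrite C_sum_S, IH, (S_INR (S n)), RtoC_plus; ring.
Qed.

Lemma C_sum_geom (x : C) (n : nat) : ((x - 1) * C_sum (fun k => x ^ k) n = x ^ S n - 1)%C.
Proof.
induction n as [|n IH].
- rewrite C_sum_0; simpl; ring.
- rewrite C_sum_S, Cmult_plus_distr_l, IH; simpl Cpow; ring.
Qed.

(** A geometric sum whose ratio [w ^ m] differs from 1 but has its [S M]-th power equal to 1. *)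
Lemma sum_unity_root (M m : nat) : (0 < m < S M)%nat ->
  C_sum (fun k => (unity_root (S M) ^ k) ^ m)%C M = RtoC 0 :> C.
Proof.
intros Hm; set (w := unity_root (S M)).
assert (E : C_sum (fun k => (w ^ k) ^ m)%C M = C_sum (fun k => (w ^ m) ^ k)%C M :> C).
{ apply C_sum_ext; intros k _; now rewrite <- !Cpow_mult_r, Nat.mul_comm. }
assert (H := C_sum_geom (w ^ m)%C M).
rewrite <- Cpow_mult_r, Nat.mul_comm, Cpow_mult_r in H; unfold w in H at 3.
rewrite unity_root_pow_N, Cpow_1_l in H by lia.
assert (Hne : (w ^ m - 1)%C <> RtoC 0).
{ intros H0; apply (unity_root_pow_neq_1 (S M) m Hm); fold w.
  replace (w ^ m)%C with (w ^ m - 1 + 1)%C by ring; rewrite H0; ring. }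
rewrite E; apply (f_equal (Cmult (/ (w ^ m - 1)))) in H.
rewrite Cmult_assoc, Cinv_l, Cmult_1_l in H by exact Hne; rewrite H.
replace (RtoC 1 - 1)%C with (RtoC 0) by ring; ring.
Qed.

(** Exchanging the sums reduces averages of a polynomial against a monomial to power sums of roots
    of unity. *)
Lemma C_poly_unity_sum (p : nat -> C) (r c : C) (M K m : nat) :
  let w := unity_root (S K) in
  C_sum (fun k => C_sum (fun j => p j * (r * w ^ k) ^ j)%C M * (c * (w ^ k) ^ m))%C K =
  C_sum (fun j => p j * r ^ j * c * C_sum (fun k => (w ^ k) ^ (j + m))%C K)%C M :> C.
Proof.
intros w.
rewrite (C_sum_ext _ (fun k => C_sum (fun j => p j * r ^ j * c * (w ^ k) ^ (j + m))%C M)).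
- rewrite (sum_n_switch (G := C_AbelianGroup)
    (fun k j => p j * r ^ j * c * (w ^ k) ^ (j + m))%C).
  apply C_sum_ext; intros j _; apply C_sum_scal.
- intros k _; rewrite Cmult_comm, <- C_sum_scal.
  apply C_sum_ext; intros j _; rewrite Cpow_mult_l, Cpow_add_r; ring.
Qed.

(** Conjugates become natural powers, so that the power sums apply to them as well. *)
Lemma Cconj_pow_unity (v : C) (N n : nat) : Cmod v = 1 -> (v ^ N)%C = RtoC 1 -> (n <= N)%nat ->
  Cconj (v ^ n) = (v ^ (N - n))%C.
Proof.
intros Hv HN Hn.
assert (E1 := Cmod2_conj (v ^ n)); rewrite Cmod_pow, Hv, !pow1 in E1.
assert (E2 : (v ^ n * v ^ (N - n) = 1)%C).
{ rewrite <- Cpow_add_r; now replace (n + (N - n))%nat with N by lia. }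
transitivity ((v ^ n * v ^ (N - n)) * Cconj (v ^ n))%C; [rewrite E2; ring|].
transitivity ((v ^ n * Cconj (v ^ n)) * v ^ (N - n))%C; [ring|].
rewrite <- E1; ring.
Qed.

Lemma Re_mul_Re (x y : C) : 2 * (Re x * Re y) = Re (x * y)%C + Re (x * Cconj y)%C.
Proof. destruct x, y; unfold Re, Cmult, Cconj; simpl; ring. Qed.

(* Averaging [Re P * (1 - Re (sigma z^n / r^n)) >= 0] over the [N]-th roots of
   unity on the circle of radius [r] isolates [Re (p 0)] and [p n]; the series is
   first truncated at [M < N / 2], so that no other coefficient contributes. *)
Lemma caratheodory_on_circle (P : C -> C) (p : nat -> C) (n : nat) (r eps : R) :
  expands_on_disc P p -> (forall z, in_disc z -> 0 < Re (P z)) ->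
  (0 < n)%nat -> 0 < r < 1 -> 0 < eps ->
  Cmod (p n) * r ^ n <= 2 * (Re (p 0%nat) + eps).
Proof.
intros HP Hre Hn Hr Heps.
set (a := fun j => Cmod (p j) * r ^ j).
assert (Ha : ex_series a) by (apply (expands_on_ex_abs 1 r P p HP); lra).
assert (Hp0 : 0 < Re (p 0%nat)).
{ assert (H0 : in_disc (RtoC 0)) by (unfold in_disc; rewrite Cmod_0; lra).
  rewrite <- (C_series_unique _ _ _ (HP _ H0) (@is_pseries_0 C_AbsRing C_NormedModule p)).
  now apply Hre. }
destruct (Ceq_dec (p n) (RtoC 0)) as [Hz | Hz].
{ rewrite Hz, Cmod_0; lra. }
destruct (proj2 (is_lim_seq_spec _ (Finite _)) (is_lim_seq_sum_n a Ha) (mkposreal eps Heps)) as [N0 HN0].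
set (M := max N0 n); specialize (HN0 M ltac:(lia)); simpl in HN0.
set (K := (2 * M)%nat); set (N := S K); set (w := unity_root N).
set (Q := fun z : C => C_sum (fun j => p j * z ^ j)%C M : C).
(* Truncation costs at most [eps] in the real part; this is the origin of [Re (X k) + eps] below. *)
assert (Happ : forall z, Cmod z = r -> - eps <= Re (Q z)).
{ intros z Hzr.
  assert (Hzd : in_disc z) by (unfold in_disc; lra).
  assert (HS := HP z Hzd); apply C_pseries_series, (C_series_tail _ _ M) in HS.
  assert (B : Cmod (P z - Q z) <= Series a - sum_n a M).
  { apply (Cmod_series_le _ (fun k => a (S M + k)%nat) _ _ HS).
    - intros k; rewrite Cmod_mult, Cmod_pow, Hzr; unfold a; lra.
    - apply is_series_incr_n; [lia|]; simpl pred.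
      replace (plus _ _) with (Series a); [now apply Series_correct|].
      change (Series a = (Series a - sum_n a M) + sum_n a M); ring. }
  assert (H1 := Hre z Hzd); assert (H2 := re_le_Cmod (P z - Q z)).
  replace (Re (P z - Q z)) with (Re (P z) - Re (Q z)) in H2
    by (destruct (P z), (Q z); reflexivity).
  apply Rabs_lt_between in HN0; apply Rabs_le_between in H2; lra. }
assert (Hcp : 0 < Cmod (p n)) by now apply Cmod_gt_0.
assert (Hcz : RtoC (Cmod (p n)) <> RtoC 0) by (intros E; apply RtoC_inj in E; lra).
(* The phase of [p n]: after averaging, [p n * Cconj sg] is the modulus of [p n]. *)
set (sg := (p n / RtoC (Cmod (p n)))%C).
assert (Hsg : Cmod sg = 1).
{ unfold sg; rewrite Cmod_div, Cmod_R, Rabs_pos_eq by (assumption || lra); field; lra. }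
assert (Hpsg : (p n * Cconj sg)%C = RtoC (Cmod (p n))).
{ assert (E := Cmod2_conj sg); rewrite Hsg in E.
  replace (p n) with (RtoC (Cmod (p n)) * sg)%C at 1 by (unfold sg; field; exact Hcz).
  rewrite <- Cmult_assoc, <- E, pow1; ring. }
set (v := fun k => (w ^ k)%C).
assert (Hv1 : forall k, Cmod (v k) = 1).
{ intros k; unfold v, w, unity_root; rewrite Cmod_pow, Cmod_cis; apply pow1. }
assert (HvN : forall k, (v k ^ N)%C = RtoC 1).
{ intros k; unfold v; rewrite <- Cpow_mult_r, Nat.mul_comm, Cpow_mult_r.
  unfold w; rewrite unity_root_pow_N by (unfold N; lia); apply Cpow_1_l. }
set (X := fun k => Q (RtoC r * v k)%C).
set (Y := fun k => (sg * v k ^ n)%C).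
assert (Hsum : 0 <= sum_n (fun k => (Re (X k) + eps) * (1 - Re (Y k))) K).
{ assert (Hterm : forall k, 0 <= (Re (X k) + eps) * (1 - Re (Y k))).
  { intros k; apply Rmult_le_pos.
    - assert (H := Happ (RtoC r * v k)%C); fold (X k) in H.
      rewrite Cmod_mult, Hv1, Cmod_R, Rabs_pos_eq in H by lra; lra.
    - assert (H := re_le_Cmod (Y k)); unfold Y at 2 in H.
      rewrite Cmod_mult, Cmod_pow, Hv1, Hsg, pow1 in H.
      apply Rabs_le_between in H; lra. }
  apply sum_n_nonneg, Hterm. }
assert (HM : (n <= M)%nat) by (unfold M; lia).
assert (Havg : forall c m, C_sum (fun k => X k * (c * v k ^ m))%C K =
   C_sum (fun j => p j * RtoC r ^ j * c * C_sum (fun k => v k ^ (j + m))%C K)%C M :> C)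
  by exact (fun c m => C_poly_unity_sum p (RtoC r) c M K m).
assert (Hroot : forall m, (0 < m < N)%nat -> C_sum (fun k => v k ^ m)%C K = RtoC 0 :> C)
  by exact (sum_unity_root K).
(* In [A0] and [A2] exactly one exponent is a multiple of [N], from [p 0] and [p n] respectively; in
   [A1] and [A3] all exponents lie strictly between 0 and [N]. *)
assert (A0 : C_sum (fun k => X k * (RtoC 1 * v k ^ 0))%C K = (RtoC (INR N) * p 0%nat)%C :> C).
{ rewrite Havg, (C_sum_single _ 0) by
    (lia || (intros j Hj Hj0; rewrite Nat.add_0_r, Hroot by (unfold N, K; lia); ring)).
  simpl (0 + 0)%nat; rewrite (C_sum_ext _ (fun _ => RtoC 1)) by reflexivity.
  rewrite C_sum_const; simpl Cpow; fold N; ring. }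
assert (A1 : C_sum (fun k => X k * Y k)%C K = RtoC 0 :> C).
{ unfold Y; rewrite Havg, (C_sum_single _ 0) by
    (lia || (intros j Hj Hj0; rewrite Hroot by (unfold N, K; lia); ring)).
  rewrite Hroot by (unfold N, K; lia); ring. }
assert (A2 : C_sum (fun k => X k * Cconj (Y k))%C K = (RtoC (INR N * (Cmod (p n) * r ^ n)))%C :> C).
{ rewrite (C_sum_ext _ (fun k => X k * (Cconj sg * v k ^ (N - n)))%C).
  2:{ intros k _; unfold Y; rewrite Cmult_conj, (Cconj_pow_unity _ N);
      [reflexivity | apply Hv1 | apply HvN | unfold N, K; lia]. }
  rewrite Havg, (C_sum_single _ n M HM).
  - rewrite (C_sum_ext _ (fun _ => RtoC 1)).
    + rewrite C_sum_const; fold N.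
      rewrite !RtoC_mult, RtoC_pow, <- Hpsg; ring.
    + intros k _; replace (n + (N - n))%nat with N by (unfold N, K; lia); apply HvN.
  - intros j Hj Hjn; destruct (Nat.lt_ge_cases j n) as [Hlt | Hge].
    + rewrite Hroot by (unfold N, K; lia); ring.
    + rewrite (C_sum_ext _ (fun k => v k ^ (j - n))%C).
      * rewrite Hroot by (unfold N, K; lia); ring.
      * intros k _; replace (j + (N - n))%nat with ((j - n) + N)%nat by (unfold N, K; lia).
        rewrite Cpow_add_r; rewrite HvN; ring. }
assert (A3 : C_sum Y K = RtoC 0 :> C).
{ unfold Y; rewrite C_sum_scal, Hroot by (unfold N, K; lia); ring. }
(* Expand the product, with [2 Re X Re Y = Re (X Y) + Re (X Cconj Y)], and insert the four
   averages. *)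
assert (Htot : 2 * sum_n (fun k => (Re (X k) + eps) * (1 - Re (Y k))) K =
   2 * (INR N * Re (p 0%nat)) + 2 * eps * INR N - INR N * (Cmod (p n) * r ^ n)).
{ rewrite <- sum_n_scal_R.
  transitivity (sum_n (fun k => Re (RtoC 2 * (X k * (RtoC 1 * v k ^ 0)) +
     (RtoC (- 1) * (X k * Y k) + (RtoC (- 1) * (X k * Cconj (Y k)) +
       (RtoC (- 2 * eps) * Y k + RtoC (2 * eps) * RtoC 1))))%C) K).
  - apply sum_n_ext; intros k; real_eq.
    transitivity (2 * Re (X k) + - (2 * (Re (X k) * Re (Y k))) - 2 * eps * Re (Y k) + 2 * eps); [ring|].
    rewrite Re_mul_Re; destruct (X k), (Y k); unfold Re, Cmult, Cplus, Cconj, RtoC; simpl; ring.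
  - rewrite <- Re_sum_n, !C_sum_plus, !C_sum_scal, A0, A1, A2, A3, C_sum_const; fold N.
    generalize (INR N) (Cmod (p n)); intros x y.
    destruct (p 0%nat); unfold Re, Cmult, Cplus, RtoC; simpl fst; simpl snd; ring. }
assert (HNpos : 0 < INR N) by (apply lt_0_INR; unfold N; lia).
apply Rmult_le_reg_l with (INR N); [exact HNpos|]; lra.
Qed.

(** Let the radius [1 - 1 / (N + 2)], which stays in [(0, 1)] from [N = 0] on, tend to 1. *)
Lemma caratheodory (P : C -> C) (p : nat -> C) (n : nat) :
  expands_on_disc P p -> (forall z, in_disc z -> 0 < Re (P z)) -> (0 < n)%nat ->
  Cmod (p n) <= 2 * Re (p 0%nat).
Proof.
intros HP Hre Hn; apply le_epsilon; intros eps Heps.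
assert (H : forall N, Cmod (p n) * (1 - / (INR N + 2)) ^ n <= 2 * (Re (p 0%nat) + eps / 2)).
{ intros N; assert (H := pos_INR N); apply (caratheodory_on_circle P); trivial; [|lra].
  assert (0 < / (INR N + 2)) by (apply Rinv_0_lt_compat; lra).
  assert (/ (INR N + 2) <= / 2) by (apply Rinv_le_contravar; lra).
  lra. }
assert (L : is_lim_seq (fun N => Cmod (p n) * (1 - / (INR N + 2)) ^ n) (Cmod (p n) * (1 - 0) ^ n)).
{ apply is_lim_seq_mult'; [apply is_lim_seq_const|].
  apply (is_lim_seq_continuous (fun y => y ^ n)); [apply derivable_continuous_pt, derivable_pt_pow|].
  apply is_lim_seq_minus'; [apply is_lim_seq_const|].
  apply is_lim_seq_ext with (2 := is_lim_seq_inv_shift 1 2).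
  intros N; rewrite Rplus_comm; unfold Rdiv; ring. }
assert (HH := is_lim_seq_le _ _ _ _ H L (is_lim_seq_const _)); simpl in HH.
rewrite Rminus_0_r, pow1 in HH; lra.
Qed.

(** * The Clausen operator *)

(** Caratheodory's inequality for the rotated [f' - beta]: the rotation preserves the moduli of the
    coefficients, and the real part at 0 is [(1 - beta) cos phi], at most [1 - beta]. *)
Lemma class_R_coeff_le (beta phi : R) (f : C -> C) (u : nat -> C) (m : nat) :
  beta < 1 -> u 1%nat = RtoC 1 -> expands_on_disc f u ->
  (forall z, in_disc z -> 0 < Re ((cos phi, sin phi) * (C_derive f z - RtoC beta))%C) ->
  (0 < m)%nat -> INR (S m) * Cmod (u (S m)) <= 2 * (1 - beta).
Proof.
intros Hbeta Hu1 Hf Hre Hm.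
set (p := fun n => (cis phi * (C_PS_derive u n - match n with O => RtoC beta | S _ => RtoC 0 end))%C).
assert (HP : expands_on_disc (fun z => cis phi * (C_derive f z - RtoC beta))%C p).
{ intros z Hz; apply C_pseries_series.
  assert (Hd := expands_on_C_derive 1 f u Hf z Hz); apply C_pseries_series in Hd.
  assert (H := C_series_scal (cis phi) _ _ (C_series_minus _ _ _ _ Hd (C_series_const0 (RtoC beta)))).
  apply C_series_ext with (2 := H); intros [|n]; unfold p; simpl Cpow; ring. }
assert (H := caratheodory _ p m HP Hre Hm).
destruct m as [|m]; [lia|].
unfold p at 1 in H; rewrite Cmod_mult, Cmod_cis, Rmult_1_l in H.
replace (C_PS_derive u (S m) - RtoC 0)%C with (C_PS_derive u (S m)) in H by ring.
unfold C_PS_derive at 1 in H; rewrite Cmod_mult, Cmod_INR in H.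
apply Rle_trans with (1 := H).
unfold p, C_PS_derive; rewrite Hu1; unfold cis, Re, Cmult, Cminus, Cplus, Copp, RtoC; simpl.
assert (Hc := COS_bound phi); nra.
Qed.

Lemma Cmod_C_poch_le (x : C) (y : R) (n : nat) :
  Cmod x <= y -> Cmod (C_poch x n) <= R_poch y n.
Proof.
intros Hxy; induction n as [|n IH]; simpl; [rewrite Cmod_1; lra|].
rewrite Cmod_mult; apply Rmult_le_compat; try apply Cmod_ge_0; [exact IH|].
apply Rle_trans with (1 := Cmod_triangle _ _); rewrite Cmod_INR; lra.
Qed.

(** Two consecutive factors [(x + 2 m) (x + 2 m + 1)] equal [4 (x / 2 + m) ((x + 1) / 2 + m)]. *)
Lemma R_poch_double (x : R) (m : nat) :
  R_poch x (2 * m) = R_poch (x / 2) m * R_poch ((x + 1) / 2) m * 4 ^ m.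
Proof.
induction m as [|m IH]; [simpl; ring|].
replace (2 * S m)%nat with (S (S (2 * m))) by lia.
cbn [R_poch pow]; rewrite IH, S_INR, mult_INR; simpl (INR 2); field.
Qed.

(** The half parameters recombine by duplication, and the powers of 4 cancel between [b] and [c]. *)
Lemma Cmod_coeff_3F2_le (a b : C) (c : R) (m : nat) : 0 < c ->
  Cmod (coeff_3F2 a (b / 2)%C ((b + 1) / 2)%C (RtoC (c / 2)) (RtoC ((c + 1) / 2)) m) <=
  binom_coeff (Cmod a) m * (R_poch (Cmod b) (2 * m) / R_poch c (2 * m)).
Proof.
intros Hc; unfold coeff_3F2, binom_coeff.
assert (D1 := R_poch_pos (c / 2) m ltac:(lra)).
assert (D2 := R_poch_pos ((c + 1) / 2) m ltac:(lra)).
assert (D3 := R_poch_pos 1 m Rlt_0_1).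
assert (D4 : 0 < 4 ^ m) by (apply pow_lt; lra).
rewrite !C_poch_RtoC, <- !RtoC_mult.
assert (HD : 0 < R_poch (c / 2) m * R_poch ((c + 1) / 2) m * R_poch 1 m)
  by (repeat apply Rmult_lt_0_compat; assumption).
rewrite Cmod_div, Cmod_R, Rabs_pos_eq by (try (intros E; apply RtoC_inj in E); lra).
rewrite !R_poch_double.
replace (R_poch (Cmod a) m / R_poch 1 m *
   (R_poch (Cmod b / 2) m * R_poch ((Cmod b + 1) / 2) m * 4 ^ m /
    (R_poch (c / 2) m * R_poch ((c + 1) / 2) m * 4 ^ m)))
  with (R_poch (Cmod a) m * R_poch (Cmod b / 2) m * R_poch ((Cmod b + 1) / 2) m /
    (R_poch (c / 2) m * R_poch ((c + 1) / 2) m * R_poch 1 m)) by (field; lra).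
apply Rmult_le_compat_r; [now apply Rlt_le, Rinv_0_lt_compat|].
assert (H2 : RtoC 2 <> RtoC 0) by (intros E; apply RtoC_inj in E; lra).
assert (M2 : Cmod (RtoC 2) = 2) by (rewrite Cmod_R; apply Rabs_pos_eq; lra).
rewrite !Cmod_mult.
repeat apply Rmult_le_compat; repeat apply Rmult_le_pos; try apply Cmod_ge_0;
  apply Cmod_C_poch_le.
- lra.
- rewrite Cmod_div, M2 by exact H2; lra.
- rewrite Cmod_div, M2 by exact H2; apply Rmult_le_compat_r; [lra|].
  apply Rle_trans with (1 := Cmod_triangle _ _); rewrite Cmod_1; lra.
Qed.

(** The point [-1] lies in the slit plane, so the sums of the Gauss series at [-1 + 1 / (N + 1)]
    converge to the value of the continuation; this is the limit that [clausen_sum] asks for. *)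
Lemma clausen_sum_2F1 (a b c : R) (F : C -> C) :
  0 < a -> 0 < b -> a + b < c -> 1 + b < c ->
  is_2F1 (RtoC a) (RtoC b) (RtoC (c - a)) F ->
  is_series (fun m => binom_coeff a m * (R_poch b (2 * m) / R_poch c (2 * m)))
    (gauss_value a b c * Re (F (RtoC (-1)))).
Proof.
intros Ha Hb Hc Hc1 HF; apply clausen_sum; trivial.
- intros y Hy; exists (Re (F (RtoC y))); apply is_2F1_series; trivial; [lra|].
  rewrite Rabs_pos_eq; lra.
- assert (Han : analytic_at F (RtoC (-1))).
  { apply HF; intros [_ H]; simpl in H; lra. }
  assert (Hh : is_lim_seq (fun N => / (INR N + 1)) 0).
  { apply is_lim_seq_ext with (2 := is_lim_seq_inv_shift 1 1).
    intros N; rewrite Rplus_comm; unfold Rdiv; ring. }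
  apply is_lim_seq_ext with (2 := analytic_at_lim F (-1) _ Han Hh).
  intros N; assert (H := pos_INR N).
  assert (0 < / (INR N + 1)) by (apply Rinv_0_lt_compat; lra).
  assert (/ (INR N + 1) <= / 1) by (apply Rinv_le_contravar; lra).
  rewrite Rinv_1 in *.
  replace (- (1 - / (INR N + 1))) with (-1 + / (INR N + 1)) by ring.
  symmetry; apply is_series_unique, is_2F1_series; trivial; [lra|].
  apply Rabs_def1; lra.
Qed.

(** Rewrites the Gamma factor of the shifted sum as that of the original one, which the hypothesis
    of the theorem factors out. *)
Lemma gauss_value_shift (a b c : R) : 0 < a -> 0 < b -> a + b + 1 < c ->
  a * R_poch b 2 / R_poch c 2 * gauss_value (a + 1) (b + 2) (c + 2) =
  gauss_value a b c * (a * R_poch b 2 / ((c - a) * (c - a - b - 1))).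
Proof.
intros Ha Hb Hc; unfold gauss_value.
replace (c + 2 - (a + 1) - (b + 2)) with (c - a - b - 1) by ring.
replace (c + 2 - (a + 1)) with (c - a + 1) by ring.
replace (c + 2 - (b + 2)) with (c - b) by ring.
replace (c + 2) with (c + INR 2) by (simpl; ring).
replace (Gamma (c - a - b)) with ((c - a - b - 1) * Gamma (c - a - b - 1)).
2:{ rewrite <- Gamma_succ by lra; f_equal; ring. }
rewrite Gamma_add_nat, Gamma_succ by lra.
assert (H1 := Gamma_pos (c - a) ltac:(lra)); assert (H2 := Gamma_pos (c - b) ltac:(lra)).
assert (H3 := R_poch_pos c 2 ltac:(lra)).
field; repeat split; lra.
Qed.

(** The weight cancels a factor of the factorial, and two leading factors of each doubled Pochhammer
    symbol are split off. The index starts at 1 since the term of weight 0 vanishes. *)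
Lemma clausen_term_shift (a b c : R) (m : nat) : 0 < c ->
  INR (S m) * (binom_coeff a (S m) * (R_poch b (2 * S m) / R_poch c (2 * S m))) =
  a * R_poch b 2 / R_poch c 2 *
  (binom_coeff (a + 1) m * (R_poch (b + 2) (2 * m) / R_poch (c + 2) (2 * m))).
Proof.
intros Hc; replace (2 * S m)%nat with (2 + 2 * m)%nat by lia.
rewrite !R_poch_add, <- !Rmult_assoc, binom_coeff_S.
replace (INR 2) with 2 by (simpl; ring).
assert (E : (INR m + a) * binom_coeff a m = a * binom_coeff (a + 1) m).
{ unfold binom_coeff, Rdiv; rewrite <- (Rmult_assoc a), <- R_poch_S_l; simpl; ring. }
rewrite E; assert (H1 := R_poch_pos c 2 Hc).
assert (H2 := R_poch_pos (c + 2) (2 * m) ltac:(lra)).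
field; lra.
Qed.

(* F and G are the two Gauss functions of the hypothesis; their parameters are
   real, hence so are their values at -1, and Re only casts these to R. *)
Theorem theorem3p2 (a b : C) (c lam beta : R) (F G : C -> C)
  (ha : a <> RtoC 0) (hb : b <> RtoC 0)
  (hc : 0 < c) (hcab : c > Cmod a + Cmod b + 1)
  (hlam : 0 < lam <= 1) (hbeta : 0 <= beta < 1)
  (hF : is_2F1 (RtoC (Cmod a + 1)) (RtoC (Cmod b + 2))
          (RtoC (c - Cmod a + 1)) F)
  (hG : is_2F1 (RtoC (Cmod a)) (RtoC (Cmod b)) (RtoC (c - Cmod a)) G)
  (hineq :
    Gamma c * Gamma (c - Cmod a - Cmod b)
      / (Gamma (c - Cmod a) * Gamma (c - Cmod b))
    * (Cmod a * R_poch (Cmod b) 2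
         / ((c - Cmod a) * (c - Cmod a - Cmod b - 1)) * Re (F (RtoC (-1)))
       + lam * Re (G (RtoC (-1))))
    <= lam * (1 / (2 * (1 - beta)) + 1)) :
  forall f : C -> C, class_R beta f ->
    class_C lam
      (clausen_operator a (b / 2) ((b + 1) / 2)
         (RtoC (c / 2)) (RtoC ((c + 1) / 2)) f)%C.
Proof.
intros f [[u (Hu0 & Hu1 & Hf)] [phi Hre]].
assert (HA : 0 < Cmod a) by now apply Cmod_gt_0.
assert (HB : 0 < Cmod b) by now apply Cmod_gt_0.
set (T := fun m => binom_coeff (Cmod a) m * (R_poch (Cmod b) (2 * m) / R_poch c (2 * m))).
fold (gauss_value (Cmod a) (Cmod b) c) in hineq.
set (gv := gauss_value (Cmod a) (Cmod b) c) in *.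
assert (S0 : is_series T (gv * Re (G (RtoC (-1))))).
{ apply clausen_sum_2F1; trivial; lra. }
(* In this form [F] is the Gauss function attached to the parameters raised by [(1, 2, 2)]. *)
replace (c - Cmod a + 1) with (c + 2 - (Cmod a + 1)) in hF by ring.
assert (S1 := clausen_sum_2F1 (Cmod a + 1) (Cmod b + 2) (c + 2) F
  ltac:(lra) ltac:(lra) ltac:(lra) ltac:(lra) hF).
apply (@is_series_scal_l _ R_NormedModule (Cmod a * R_poch (Cmod b) 2 / R_poch c 2)) in S1.
apply is_series_ext with (b := fun m => INR (S m) * T (S m)) in S1.
2:{ intros m; symmetry; unfold T; now apply clausen_term_shift. }
assert (T0 : T 0%nat = 1) by (unfold T, binom_coeff; simpl; field).
(* Removing [T 0 = 1] accounts for the [+ 1] on the right of the hypothesis. *)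
assert (S0' : is_series (fun m => T (S m)) (gv * Re (G (RtoC (-1))) - 1)).
{ apply is_series_incr_1; rewrite T0.
  replace (plus _ _) with (gv * Re (G (RtoC (-1)))); [exact S0|].
  unfold plus; simpl; ring. }
assert (HS := is_series_plus _ _ _ _ S1 (@is_series_scal_l _ R_NormedModule lam _ _ S0')).
apply is_series_ext with (b := fun m => (INR (S m) + lam) * T (S m)) in HS.
2:{ intros m; unfold plus, scal; simpl; unfold mult; simpl; ring. }
set (W := Cmod a * R_poch (Cmod b) 2 / R_poch c 2 *
    (gauss_value (Cmod a + 1) (Cmod b + 2) (c + 2) * Re (F (RtoC (-1))))
  + lam * (gv * Re (G (RtoC (-1))) - 1)).
change (is_series (fun m => (INR (S m) + lam) * T (S m)) W) in HS.
assert (HW : 2 * (1 - beta) * W <= lam).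
{ replace W with (gv * (Cmod a * R_poch (Cmod b) 2 / ((c - Cmod a) * (c - Cmod a - Cmod b - 1))
      * Re (F (RtoC (-1))) + lam * Re (G (RtoC (-1)))) - lam).
  - apply Rmult_le_compat_l with (r := 2 * (1 - beta)) in hineq; [|lra].
    replace (2 * (1 - beta) * (lam * (1 / (2 * (1 - beta)) + 1)))
      with (lam + 2 * (1 - beta) * lam) in hineq by (field; lra).
    lra.
  - unfold W; rewrite <- (Rmult_assoc _ (gauss_value _ _ _)), gauss_value_shift by lra.
    fold gv; ring. }
set (v := fun n : nat => match n with
    | O => RtoC 0
    | S m => (coeff_3F2 a (b / 2) ((b + 1) / 2) (RtoC (c / 2)) (RtoC ((c + 1) / 2)) m
              * taylor_coeff f n)%C
    end).
change (clausen_operator a (b / 2) ((b + 1) / 2) (RtoC (c / 2)) (RtoC ((c + 1) / 2)) f)%C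
  with (C_PSeries v).
assert (Hv1 : v 1%nat = RtoC 1).
{ unfold v; rewrite (taylor_coeff_expands f u) by exact Hf; rewrite Hu1.
  unfold coeff_3F2; simpl; field. }
assert (Hcoef : forall m, Cmod (v (S m)) <= T m * Cmod (u (S m))).
{ intros m; unfold v; rewrite (taylor_coeff_expands f u) by exact Hf.
  rewrite Cmod_mult; apply Rmult_le_compat_r; [apply Cmod_ge_0|].
  now apply Cmod_coeff_3F2_le. }
assert (Tpos : forall m, 0 < T m).
{ intros m; unfold T; apply Rmult_lt_0_compat; [now apply binom_coeff_pos|].
  apply Rdiv_lt_0_compat; apply R_poch_pos; lra. }
assert (Hu : forall m, INR (S (S m)) * Cmod (u (S (S m))) <= 2 * (1 - beta)).
{ intros m; apply (class_R_coeff_le beta phi f); trivial; [lra | lia]. }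
(* A crude uniform bound, enough for convergence of the image series in the disc. *)
assert (Hu2 : forall m, Cmod (u (S m)) <= 2).
{ intros [|m]; [rewrite Hu1, Cmod_1; lra|].
  specialize (Hu m); rewrite !S_INR in Hu; assert (H := pos_INR m).
  assert (H0 := Cmod_ge_0 (u (S (S m)))); nra. }
assert (Hg : expands_on_disc (C_PSeries v) v).
{ intros z Hz.
  assert (Hl : exists l, C_series (fun n => (v n * z ^ n)%C) l).
  { assert (Hl : exists l, C_series (fun n => (v (S n) * z ^ S n)%C) l).
    { apply C_ex_series_le with (fun m => T m * 2).
      - intros m; rewrite Cmod_mult, Cmod_pow.
        assert (Hz1 : 0 <= Cmod z ^ S m <= 1).
        { split; [apply pow_le, Cmod_ge_0|]; rewrite <- (pow1 (S m)); apply pow_incr.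
          split; [apply Cmod_ge_0 | now apply Rlt_le]. }
        assert (Hm : Cmod (v (S m)) <= T m * 2).
        { apply Rle_trans with (1 := Hcoef m), Rmult_le_compat_l; [apply Rlt_le, Tpos | apply Hu2]. }
        assert (H0 := Cmod_ge_0 (v (S m))); nra.
      - apply ex_series_scal_r; now exists (gv * Re (G (RtoC (-1)))). }
    destruct Hl as [l Hl]; eexists; exact (C_series_decr_1 (fun n => v n * z ^ n)%C l Hl). }
  destruct Hl as [l Hl]; apply C_pseries_series in Hl.
  now rewrite (C_PSeries_unique v z l Hl). }
split; [exists v; repeat split; trivial|].
(* Passing to [z] times the derivative multiplies the [n]-th coefficient by [n]; the bound
   [n |u n| <= 2 (1 - beta)] absorbs this factor and leaves the weighted sum of [T]. *)
set (t := fun m => (INR (S m) + lam) * Cmod (RtoC (INR (S (S m))) * v (S (S m)))%C).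
assert (Ht : forall m, 0 <= t m <= 2 * (1 - beta) * ((INR (S m) + lam) * T (S m))).
{ intros m; unfold t; assert (H := pos_INR (S m)); split.
  - apply Rmult_le_pos; [lra | apply Cmod_ge_0].
  - rewrite Cmod_mult, Cmod_INR.
    apply Rle_trans with ((INR (S m) + lam) * (T (S m) * (2 * (1 - beta)))); [|right; ring].
    apply Rmult_le_compat_l; [lra|].
    apply Rle_trans with (INR (S (S m)) * (T (S m) * Cmod (u (S (S m))))).
    + apply Rmult_le_compat_l; [apply pos_INR | apply Hcoef].
    + replace (INR (S (S m)) * (T (S m) * Cmod (u (S (S m)))))
        with (T (S m) * (INR (S (S m)) * Cmod (u (S (S m))))) by ring.
      apply Rmult_le_compat_l; [apply Rlt_le, Tpos | apply Hu]. }
assert (HS2 := @is_series_scal_l _ R_NormedModule (2 * (1 - beta)) _ _ HS).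
apply class_S_of_coeffs with (Series t) (fun n => RtoC (INR n) * v n)%C.
- lra.
- simpl; ring.
- rewrite Hv1; simpl; ring.
- now apply expands_on_z_derive.
- apply Series_correct, ex_series_abs_le with (2 := ex_intro _ _ HS2).
  intros m; rewrite Rabs_pos_eq; apply Ht.
- apply Rle_trans with (2 := HW); rewrite <- (is_series_unique _ _ HS2 : _ = 2 * (1 - beta) * W).
  apply Series_le; [exact Ht | now exists (2 * (1 - beta) * W)].
Qed.
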